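(* Let $\lambda\geq 1$. Then $\mathcal{B}_H(\lambda)\subset h^p$ for every $p$ with $$0<p<p_0(\lambda)=\frac{4}{(\lambda+3)(\lambda-1)},$$ where $p_0(\lambda)=\infty$ if $\lambda=1$.
   Context: $\mathbb{D}=\{z\in\mathbb{C}:|z|<1\}$. A harmonic mapping in $\mathbb{D}$ is written $f=h+\overline{g}$ with $h,g$ analytic in $\mathbb{D}$, $g(0)=0$; it is sense-preserving if $|h'|^2-|g'|^2>0$ in $\mathbb{D}$. Its pre-Schwarzian derivative and norm are $$P_f=\frac{h''\overline{h'}-g''\overline{g'}}{|h'|^2-|g'|^2},\qquad \|P_f\|=\sup_{z\in\mathbb{D}}(1-|z|^2)|P_f(z)|.$$ $\mathcal{H}$ is the set of sense-preserving harmonic mappings $f=h+\overline g$ in $\mathbb{D}$ with $h(0)=h'(0)-1=g(0)=0$; for $\lambda\ge0$, $\mathcal{B}_H(\lambda)=\{f\in\mathcal{H}:\|P_f\|\le\lambda\}$. For $0<p<\infty$, $h^p$ is the space of harmonic mappings $f$ in $\mathbb{D}$ with $\sup_{0<r<1}\left(\frac1{2\pi}\int_0^{2\pi}|f(re^{i\theta})|^p\,d\theta\right)^{1/p}<\infty$. *)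

(* Defs.v *)
From Stdlib Require Import Reals.
From Coquelicot Require Import Coquelicot.

Open Scope R_scope.

Definition in_disk (z : C) : Prop := Cmod z < 1.

Definition analytic_on_disk (h : C -> C) : Prop :=
  forall z : C, in_disk z -> ex_derive (K := C_AbsRing) (V := C_NormedModule) h z.

(* All functions are total on [C]; only their values on the disk matter.  The
   condition [g 0 = 0] determines [h] and [g] on the disk from [f]. *)
Definition harmonic_decomposition (f h g : C -> C) : Prop :=
  analytic_on_disk h /\ analytic_on_disk g /\ g 0%C = 0%C /\
  forall z : C, in_disk z -> f z = (h z + Cconj (g z))%C.

Definition harmonic_mapping (f : C -> C) : Prop :=
  exists h g : C -> C, harmonic_decomposition f h g.

Definition jacobian (h g : C -> C) (z : C) : R :=
  Cmod (C_derive h z) ^ 2 - Cmod (C_derive g z) ^ 2.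

Definition sense_preserving (h g : C -> C) : Prop :=
  forall z : C, in_disk z -> 0 < jacobian h g z.

Definition pre_schwarzian (h g : C -> C) (z : C) : C :=
  ((C_derive (C_derive h) z * Cconj (C_derive h z)
    - C_derive (C_derive g) z * Cconj (C_derive g z))
   / RtoC (jacobian h g z))%C.

Definition pre_schwarzian_norm (h g : C -> C) : Rbar :=
  Lub_Rbar (fun y : R => exists z : C,
    in_disk z /\ y = (1 - Cmod z ^ 2) * Cmod (pre_schwarzian h g z)).

Definition class_H (f h g : C -> C) : Prop :=
  harmonic_decomposition f h g /\ sense_preserving h g /\
  h 0%C = 0%C /\ C_derive h 0%C = 1%C.

Definition class_BH (lambda : R) (f : C -> C) : Prop :=
  exists h g : C -> C,
    class_H f h g /\ Rbar_le (pre_schwarzian_norm h g) (Finite lambda).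

(* [Rpower 0 p] is [1] in the standard library, hence the case distinction;
   used for [0 <= x] and [0 < p] only. *)
Definition rpow (x p : R) : R :=
  if Req_EM_T x 0 then 0 else Rpower x p.

(* A harmonic [f] is continuous on the disk, so for [0 < p] and [0 < r < 1] the
   integrand is continuous and [RInt] is its genuine Riemann integral. *)
Definition integral_mean (p : R) (f : C -> C) (r : R) : R :=
  rpow (/ (2 * PI) *
        RInt (fun t : R => rpow (Cmod (f (r * cos t, r * sin t))) p) 0 (2 * PI))
       (/ p).

Definition hardy_harmonic (p : R) (f : C -> C) : Prop :=
  harmonic_mapping f /\
  Rbar_lt (Lub_Rbar (fun y : R =>
             exists r : R, 0 < r < 1 /\ y = integral_mean p f r))
          p_infty.

Definition p0 (lambda : R) : Rbar :=
  if Req_EM_T lambda 1 then p_infty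
  else Finite (4 / ((lambda + 3) * (lambda - 1))).

(* Main.v *)
Require Import Defs.
From Stdlib Require Import Reals Lra Psatz.
From Coquelicot Require Import Coquelicot.

(** Write [a = (lambda + 1) / 2], [k = h'] and let [om = g' / h'] be the
    dilatation, a holomorphic map of the disk into itself.  Since
    [P_f = h'' / h' - om' conj(om) / (1 - |om|^2)], the Schwarz-Pick inequality
    gives [(1 - |z|^2) |h'' / h'| <= lambda + 1 = 2 a]
    ([analytic_pre_schwarzian_bound]).  Everything else is a statement about
    [k] alone, because [|f(z2) - f(z1)|] is at most twice the length of the
    image of the segment under [h].

    The function [k] has no zeros, so [u = |k|^p] is smooth.  In the
    logarithmic coordinates [z = e^(x+iy)], [x < 0], put [L = z k'(z) / k(z)];
    then [u_x = p u Re L], [u_y = - p u Im L], the Laplacian of [u] is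
    [p^2 u |L|^2], and its [u_yy] part integrates to zero over a period.  Hence
    [J(x) = int |k(e^(x+iy))|^p dy] satisfies [J'' = int p^2 u |L|^2 dy].  Since
    [|L| <= 2 a e^x / (1 - e^(2x)) <= a / |x|], we get
    [J'' <= (p a)^2 J / x^2] ([mean_differential_inequality]).  The power
    [|x|^(-b)] with [b (b + 1) = (p a)^2] solves the corresponding equation, and
    a Wronskian argument yields [J(x) = O(|x|^(-b))] as [x] increases to [0]
    ([ode_comparison]).  The hypothesis on [p] reads [p (a^2 - 1) < 1], that is
    [(p a)^2 < p (p + 1)], which says exactly that [b < p]
    ([critical_exponent]).

    It remains to integrate [k] radially.  As [|L| <= a / |x|], the modulus of
    [k] changes by a bounded factor between [x = - 2 t] and [x = - t], so that
    [|f(- t)| <= |f(- 2 t)| + A (2 t) |k(- 2 t)|].  Choose [c] with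
    [b / p < c < 1].  If [M] bounds all the [s^c |k(- s)|] with [s] in
    [2 t, 4 t, 8 t, ...], then [|f(- t)| <= B + A M sum s^(1 - c)], a geometric
    sum; and [M^p] may be taken of the order of [sum s^(c p) |k(- s)|^p], whose
    integral is at most [K sum s^(c p - b)], again a geometric sum.

    Analyticity here means pointwise complex differentiability, so the
    underlying complex analysis starts from Goursat's theorem.  It is used in logarithmic coordinates: a rectangle
    [x1 <= x <= x2], [0 <= y <= 2 pi] has cancelling horizontal sides, whence
    integrals over concentric circles agree.  This gives the mean value property,
    Cauchy's formula, the differentiability of [h'], and Schwarz's lemma. *)

Open Scope R_scope.

Notation ccontinuous := (@continuous C_UniformSpace C_UniformSpace).
Notation clocally := (@locally C_UniformSpace).

(** * Continuity and complex differentiation on [C] *)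

(** The structures on [C] make goals appear over [UniformSpace.sort C_UniformSpace],
    where [ring] and [field] do not recognise the complex field. *)
Ltac cring := match goal with |- ?a = ?b =>
  change (UniformSpace.sort C_UniformSpace) with C in *; change (@eq C a b); ring end.
Ltac cfield := match goal with |- ?a = ?b =>
  change (UniformSpace.sort C_UniformSpace) with C in *; change (@eq C a b); field end.

Lemma locally_C_iff (P : C -> Prop) (z : C) :
  clocally z P <->
  exists d, 0 < d /\ forall w, Cmod (w - z) < d -> P w.
Proof.
split.
- intros [d Hd]; exists d; split; [apply cond_pos|].
  intros w Hw; apply Hd, C_NormedModule_mixin_compat1, Hw.
- intros [d [Hd H]].
  assert (Hs : 0 < d / sqrt 2) by (apply Rdiv_lt_0_compat; [lra|apply Rlt_sqrt2_0]).
  exists (mkposreal _ Hs); intros w Hw; apply H.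
  apply (C_NormedModule_mixin_compat2 z w) in Hw; simpl in Hw.
  replace (sqrt 2 * (d / sqrt 2)) with d in Hw; [exact Hw|].
  field; apply Rgt_not_eq, Rlt_sqrt2_0.
Qed.

Lemma ccont_eps {T : UniformSpace} (f : T -> C) (z : T) :
  continuous (U := C_UniformSpace) f z <->
  forall eps, 0 < eps -> locally z (fun w => Cmod (f w - f z) < eps).
Proof.
split.
- intros H eps He. refine (H (fun v => Cmod (v - f z) < eps) _). apply locally_C_iff. exists eps; auto.
- intros H P HP. apply locally_C_iff in HP; destruct HP as [d [Hd HP]].
  unfold filtermap. apply filter_imp with (2 := H d Hd); auto.
Qed.

Lemma ccont_pair {T : UniformSpace} (f g : T -> R) (z : T) :
  continuous f z -> continuous g z ->
  continuous (U := C_UniformSpace) (fun w => ((f w, g w) : C)) z.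
Proof.
intros Hf Hg. apply (continuous_comp_2 f g (fun x y => ((x, y) : R * R)) z Hf Hg).
apply continuous_ext with (f := fun p : R * R => p); [intros [? ?]; reflexivity|apply continuous_id].
Qed.

Lemma ccont_fst {T : UniformSpace} (f : T -> C) (z : T) :
  continuous (U := C_UniformSpace) f z -> continuous (fun w => fst (f w)) z.
Proof. intros H. exact (continuous_comp f (fst : R*R->R) z H (continuous_fst (fst (f z)) (snd (f z)) )). Qed.

Lemma ccont_snd {T : UniformSpace} (f : T -> C) (z : T) :
  continuous (U := C_UniformSpace) f z -> continuous (fun w => snd (f w)) z.
Proof. intros H. exact (continuous_comp f (snd : R*R->R) z H (continuous_snd (fst (f z)) (snd (f z)) )). Qed.

Lemma ccont_plus {T : UniformSpace} (f g : T -> C) (z : T) :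
  continuous (U := C_UniformSpace) f z -> continuous (U := C_UniformSpace) g z ->
  continuous (U := C_UniformSpace) (fun w => (f w + g w)%C) z.
Proof.
intros Hf Hg; apply ccont_pair;
  [apply (continuous_plus (V := R_NormedModule) (fun w => fst (f w)) (fun w => fst (g w)))
  |apply (continuous_plus (V := R_NormedModule) (fun w => snd (f w)) (fun w => snd (g w)))];
  auto using @ccont_fst, @ccont_snd.
Qed.

Lemma ccont_opp {T : UniformSpace} (f : T -> C) (z : T) :
  continuous (U := C_UniformSpace) f z ->
  continuous (U := C_UniformSpace) (fun w => (- f w)%C) z.
Proof.
intros Hf; apply ccont_pair;
  [apply (continuous_opp (V := R_NormedModule) (fun w => fst (f w)))
  |apply (continuous_opp (V := R_NormedModule) (fun w => snd (f w)))];
  auto using @ccont_fst, @ccont_snd.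
Qed.

Lemma ccont_minus {T : UniformSpace} (f g : T -> C) (z : T) :
  continuous (U := C_UniformSpace) f z -> continuous (U := C_UniformSpace) g z ->
  continuous (U := C_UniformSpace) (fun w => (f w - g w)%C) z.
Proof. intros Hf Hg; apply (ccont_plus f (fun w => - g w)%C); auto using @ccont_opp. Qed.

Lemma ccont_mult {T : UniformSpace} (f g : T -> C) (z : T) :
  continuous (U := C_UniformSpace) f z -> continuous (U := C_UniformSpace) g z ->
  continuous (U := C_UniformSpace) (fun w => (f w * g w)%C) z.
Proof.
intros Hf Hg.
pose proof (ccont_fst f z Hf). pose proof (ccont_snd f z Hf).
pose proof (ccont_fst g z Hg). pose proof (ccont_snd g z Hg).
apply ccont_pair;
  [apply (continuous_minus (V := R_NormedModule) (fun w => fst (f w) * fst (g w)) (fun w => snd (f w) * snd (g w)))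
  |apply (continuous_plus (V := R_NormedModule) (fun w => fst (f w) * snd (g w)) (fun w => snd (f w) * fst (g w)))];
  apply (continuous_mult (K := R_AbsRing)); auto.
Qed.

Lemma norm_sqr_cont {T : UniformSpace} (f : T -> C) (z : T) :
  continuous (U := C_UniformSpace) f z ->
  continuous (fun w => fst (f w) ^ 2 + snd (f w) ^ 2) z.
Proof.
intros Hf. pose proof (ccont_fst f z Hf) as H1. pose proof (ccont_snd f z Hf) as H2.
apply (continuous_ext (fun w => fst (f w) * fst (f w) + snd (f w) * snd (f w))).
{ intros w. change (fst (f w) * fst (f w) + snd (f w) * snd (f w) = fst (f w) ^ 2 + snd (f w) ^ 2).
  ring. }
exact (continuous_plus (V := R_NormedModule) _ _ z
  (continuous_mult (K := R_AbsRing) _ _ z H1 H1) (continuous_mult (K := R_AbsRing) _ _ z H2 H2)).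
Qed.

Lemma ccont_Cmod {T : UniformSpace} (f : T -> C) (z : T) :
  continuous (U := C_UniformSpace) f z -> continuous (fun w => Cmod (f w)) z.
Proof.
intros Hf. unfold Cmod. apply continuous_comp with (f := fun w => fst (f w) ^ 2 + snd (f w) ^ 2).
- apply norm_sqr_cont, Hf.
- apply continuous_sqrt.
Qed.

Lemma ccont_inv {T : UniformSpace} (f : T -> C) (z : T) :
  f z <> 0%C -> continuous (U := C_UniformSpace) f z ->
  continuous (U := C_UniformSpace) (fun w => (/ f w)%C) z.
Proof.
intros H0 Hf.
pose proof (ccont_fst f z Hf). pose proof (ccont_snd f z Hf).
assert (Hc : continuous (fun w => / (fst (f w) ^ 2 + snd (f w) ^ 2)) z).
{ apply continuous_comp with (f := fun w => fst (f w) ^ 2 + snd (f w) ^ 2).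
  - apply norm_sqr_cont, Hf.
  - apply continuous_Rinv.
    intros E. apply H0, Cmod_eq_0. unfold Cmod. rewrite E. apply sqrt_0. }
unfold Cinv; apply ccont_pair; unfold Rdiv; apply (continuous_mult (K := R_AbsRing)); auto.
apply (continuous_opp (V := R_NormedModule)); auto.
Qed.

Lemma ccont_div {T : UniformSpace} (f g : T -> C) (z : T) :
  g z <> 0%C ->
  continuous (U := C_UniformSpace) f z -> continuous (U := C_UniformSpace) g z ->
  continuous (U := C_UniformSpace) (fun w => (f w / g w)%C) z.
Proof. intros H0 Hf Hg; apply (ccont_mult f (fun w => / g w)%C); auto using @ccont_inv. Qed.

Lemma ccont_conj {T : UniformSpace} (f : T -> C) (z : T) :
  continuous (U := C_UniformSpace) f z ->
  continuous (U := C_UniformSpace) (fun w => Cconj (f w)) z.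
Proof.
intros Hf; apply ccont_pair; [apply ccont_fst, Hf|].
apply (continuous_opp (V := R_NormedModule)), ccont_snd, Hf.
Qed.

(** Complex differentiability in Caratheodory's form: the difference quotient
    extends continuously to [z].  Products, inverses and composites then reduce
    to the continuity of the extended quotients; [cderiv_iff] relates this to
    [is_derive]. *)
Definition cderiv (k : C -> C) (z l : C) : Prop :=
  exists q : C -> C, ccontinuous q z /\ q z = l /\
    clocally z (fun w => k w = (k z + q w * (w - z))%C).

Lemma cderiv_intro (k : C -> C) (z l : C) :
  (forall eps, 0 < eps -> clocally z (fun w =>
     Cmod (k w - k z - l * (w - z))%C <= eps * Cmod (w - z)%C)) -> cderiv k z l.
Proof.
intros H.
exists (fun w => if Ceq_dec w z then l else ((k w - k z) / (w - z))%C).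
assert (Hz : (if Ceq_dec z z then l else ((k z - k z) / (z - z))%C) = l)
  by (destruct (Ceq_dec z z); congruence).
split; [|split; [exact Hz|]].
- apply ccont_eps; intros eps He. rewrite Hz.
  apply filter_imp with (2 := H (eps / 2) (ltac:(lra))).
  intros w Hw. destruct (Ceq_dec w z) as [E|E].
  + replace (l - l)%C with (RtoC 0) by cring; rewrite Cmod_0; lra.
  + assert (Hwz : (w - z)%C <> 0%C) by (intros E'; apply E; rewrite <- (Cplus_0_r z), <- E'; cring).
    replace ((k w - k z) / (w - z) - l)%C with ((k w - k z - l * (w - z)) / (w - z))%C by (cfield; auto).
    rewrite Cmod_div by auto. apply Cmod_gt_0 in Hwz.
    apply Rle_lt_trans with (eps / 2); [|lra].
    apply Rmult_le_reg_r with (1 := Hwz). unfold Rdiv at 1. rewrite Rmult_assoc, Rinv_l by lra. lra.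
- apply filter_forall; intros w. destruct (Ceq_dec w z) as [->|E]; [cring|].
  cfield. intros E'; apply E; rewrite <- (Cplus_0_r z), <- E'; cring.
Qed.

Lemma cderiv_elim (k : C -> C) (z l : C) : cderiv k z l ->
  forall eps, 0 < eps -> clocally z (fun w =>
     Cmod (k w - k z - l * (w - z))%C <= eps * Cmod (w - z)%C).
Proof.
intros [q [Hq [Hl Hk]]] eps He.
destruct (ccont_eps q z) as [H1 _].
generalize (filter_and _ _ (H1 Hq eps He) Hk). apply filter_imp.
intros w [Hw E]. rewrite E, <- Hl.
replace (k z + q w * (w - z) - k z - q z * (w - z))%C with ((q w - q z) * (w - z))%C by cring.
rewrite Cmod_mult. apply Rmult_le_compat_r; [apply Cmod_ge_0|lra].
Qed.

Lemma cderiv_iff (k : C -> C) (z l : C) :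
  cderiv k z l <-> is_derive (K := C_AbsRing) (V := C_NormedModule) k z l.
Proof.
split; intros H.
- split; [apply (is_linear_scal_l (K := C_AbsRing) (V := C_NormedModule))|].
  intros x Hx. pose proof (is_filter_lim_locally_unique (V := AbsRing_NormedModule C_AbsRing) z x Hx) as <-.
  intros eps.
  destruct (proj1 (locally_C_iff _ _) (cderiv_elim k z l H eps (cond_pos eps))) as [d [Hd Hb]].
  exists (mkposreal d Hd). intros w Hw. specialize (Hb w Hw).
  assert (E : (k w - k z - (w - z) * l)%C = (k w - k z - l * (w - z))%C) by cring.
  rewrite <- E in Hb. exact Hb.
- apply cderiv_intro. intros eps He.
  destruct H as [_ H]. specialize (H z (fun P HP => HP) (mkposreal eps He)).
  apply locally_C_iff. destruct H as [d H]; exists d; split; [apply cond_pos|].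
  intros w Hw; specialize (H w Hw). simpl in H.
  assert (E : (k w - k z - l * (w - z))%C = (k w - k z - (w - z) * l)%C) by cring.
  rewrite E. exact H.
Qed.

Lemma cderiv_C_derive (k : C -> C) (z l : C) : cderiv k z l -> C_derive k z = l.
Proof. intros H; apply is_C_derive_unique, cderiv_iff, H. Qed.

Lemma cderiv_cont (k : C -> C) (z l : C) : cderiv k z l ->
  ccontinuous k z.
Proof.
intros [q [Hq [_ Hk]]].
apply (continuous_ext_loc _ (fun w => (k z + q w * (w - z))%C)).
{ apply filter_imp with (2 := Hk). intros; symmetry; auto. }
apply ccont_plus; [apply continuous_const|].
apply ccont_mult; auto. apply ccont_minus; [apply continuous_id|apply continuous_const].
Qed.

Lemma cderiv_const (c z : C) : cderiv (fun _ => c) z 0%C.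
Proof.
exists (fun _ => 0%C); repeat split; [apply continuous_const|].
apply filter_forall; intros; cring.
Qed.

Lemma cderiv_id (z : C) : cderiv (fun w => w) z 1%C.
Proof.
exists (fun _ => 1%C); repeat split; [apply continuous_const|].
apply filter_forall; intros; cring.
Qed.

Lemma cderiv_plus (f g : C -> C) (z a b : C) :
  cderiv f z a -> cderiv g z b -> cderiv (fun w => f w + g w)%C z (a + b)%C.
Proof.
intros [q [Hq [Eq Lq]]] [s [Hs [Es Ls]]].
exists (fun w => q w + s w)%C; split; [apply ccont_plus; auto|split; [congruence|]].
generalize (filter_and _ _ Lq Ls); apply filter_imp; intros w [-> ->]; cring.
Qed.

Lemma cderiv_mult (f g : C -> C) (z a b : C) :
  cderiv f z a -> cderiv g z b -> cderiv (fun w => f w * g w)%C z (a * g z + f z * b)%C.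
Proof.
intros Hf Hg. pose proof (cderiv_cont _ _ _ Hg) as Cg.
destruct Hf as [q [Hq [Eq Lq]]], Hg as [s [Hs [Es Ls]]].
exists (fun w => q w * g w + f z * s w)%C; split; [|split; [congruence|]].
- apply ccont_plus; apply ccont_mult; auto; apply continuous_const.
- generalize (filter_and _ _ Lq Ls); apply filter_imp; intros w [Ef Eg].
  rewrite Ef. replace (s w * (w - z))%C with (g w - g z)%C by (rewrite Eg; cring).
  rewrite Eg. cring.
Qed.

Lemma cderiv_opp (f : C -> C) (z a : C) : cderiv f z a -> cderiv (fun w => - f w)%C z (- a)%C.
Proof.
intros [q [Hq [Eq Lq]]].
exists (fun w => - q w)%C; split; [apply ccont_opp; auto|split; [congruence|]].
apply filter_imp with (2 := Lq); intros w ->; cring.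
Qed.

Lemma cderiv_minus (f g : C -> C) (z a b : C) :
  cderiv f z a -> cderiv g z b -> cderiv (fun w => f w - g w)%C z (a - b)%C.
Proof. intros Hf Hg; apply (cderiv_plus f (fun w => - g w)%C); auto using cderiv_opp. Qed.

Lemma cderiv_comp (f g : C -> C) (z a b : C) :
  cderiv f (g z) a -> cderiv g z b -> cderiv (fun w => f (g w)) z (a * b)%C.
Proof.
intros Hf Hg. pose proof (cderiv_cont _ _ _ Hg) as Cg.
destruct Hf as [q [Hq [Eq Lq]]], Hg as [s [Hs [Es Ls]]].
exists (fun w => q (g w) * s w)%C; split; [|split; [congruence|]].
- apply ccont_mult; auto. apply (continuous_comp g q); auto.
- apply Cg in Lq.
  change (clocally z (fun w => f (g w) = (f (g z) + q (g w) * (g w - g z))%C)) in Lq.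
  generalize (filter_and _ _ Lq Ls); apply filter_imp.
  intros w [Ef Eg]. rewrite Ef, <- Cmult_assoc.
  f_equal. f_equal. rewrite Eg. cring.
Qed.

Lemma ccont_neq0 {T : UniformSpace} (f : T -> C) (z : T) : f z <> 0%C ->
  continuous (U := C_UniformSpace) f z -> locally z (fun w => f w <> 0%C).
Proof.
intros H0 Hf. apply Cmod_gt_0 in H0.
generalize (proj1 (ccont_eps f z) Hf _ H0); apply filter_imp.
intros w Hw E. rewrite E in Hw.
replace (0 - f z)%C with (- f z)%C in Hw by cring. rewrite Cmod_opp in Hw; lra.
Qed.

Lemma cderiv_inv (g : C -> C) (z b : C) : g z <> 0%C ->
  cderiv g z b -> cderiv (fun w => / g w)%C z (- b / (g z * g z))%C.
Proof.
intros H0 Hg. pose proof (cderiv_cont _ _ _ Hg) as Cg.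
destruct Hg as [s [Hs [Es Ls]]].
exists (fun w => - s w / (g w * g z))%C; split; [|split; [congruence|]].
- apply ccont_div; [apply Cmult_neq_0; auto|apply ccont_opp; auto|].
  apply ccont_mult; auto; apply continuous_const.
- generalize (filter_and _ _ Ls (ccont_neq0 g z H0 Cg)); apply filter_imp.
  intros w [Eg Hn].
  replace (- s w / (g w * g z) * (w - z))%C with (- (s w * (w - z)) / (g w * g z))%C by (cfield; auto).
  replace (s w * (w - z))%C with (g w - g z)%C by (rewrite Eg at 1; cring).
  cfield; auto.
Qed.

Lemma cderiv_div (f g : C -> C) (z a b : C) : g z <> 0%C ->
  cderiv f z a -> cderiv g z b ->
  cderiv (fun w => f w / g w)%C z ((a * g z - f z * b) / (g z * g z))%C.
Proof.
intros H0 Hf Hg.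
replace ((a * g z - f z * b) / (g z * g z))%C with (a * / g z + f z * (- b / (g z * g z)))%C by (cfield; auto).
apply (cderiv_mult f (fun w => / g w)%C); auto using cderiv_inv.
Qed.

Lemma cderiv_ext_loc (f g : C -> C) (z l : C) :
  clocally z (fun w => f w = g w) -> cderiv f z l -> cderiv g z l.
Proof.
intros He [q [Hq [Eq Lq]]]. exists q; split; [auto|split; [auto|]].
pose proof (locally_singleton _ _ He) as E0.
generalize (filter_and _ _ He Lq); apply filter_imp. intros w [E1 E2]. congruence.
Qed.

(** * Complex-valued integrals over real intervals *)

Lemma C_ext (a b : C) : fst a = fst b -> snd a = snd b -> a = b.
Proof. destruct a, b; simpl; congruence. Qed.

Lemma Rabs_fst_le_Cmod (z : C) : Rabs (fst z) <= Cmod z.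
Proof. apply Rle_trans with (2 := Rmax_Cmod z), Rmax_l. Qed.

Lemma Rabs_snd_le_Cmod (z : C) : Rabs (snd z) <= Cmod z.
Proof. apply Rle_trans with (2 := Rmax_Cmod z), Rmax_r. Qed.

Lemma Cmod_le_sum (z : C) : Cmod z <= Rabs (fst z) + Rabs (snd z).
Proof.
destruct z as [x y]; simpl.
replace ((x, y) : C) with (RtoC x + Ci * RtoC y)%C by (apply C_ext; simpl; ring).
apply Rle_trans with (1 := Cmod_triangle _ _).
rewrite Cmod_mult, Cmod_Ci, !Cmod_R; lra.
Qed.

Lemma is_derive_eps (f : R -> R) (x l : R) :
  (forall eps, 0 < eps -> exists d, 0 < d /\ forall y, Rabs (y - x) < d ->
     Rabs (f y - f x - l * (y - x)) <= eps * Rabs (y - x)) -> is_derive f x l.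
Proof.
intros H. split; [apply (is_linear_scal_l (K := R_AbsRing) (V := R_NormedModule))|].
intros z Hz. pose proof (is_filter_lim_locally_unique (V := R_NormedModule) x z Hz) as <-.
intros eps. destruct (H eps (cond_pos eps)) as [d [Hd Hb]].
exists (mkposreal d Hd). intros y Hy. specialize (Hb y Hy).
replace (f y - f x - l * (y - x)) with (f y - f x - (y - x) * l) in Hb by ring. exact Hb.
Qed.

Lemma cderiv_line (k : C -> C) (w d : C) (t : R) (l : C) :
  cderiv k (w + RtoC t * d)%C l ->
  is_derive (fun s => fst (k (w + RtoC s * d)%C)) t (fst (l * d)%C) /\
  is_derive (fun s => snd (k (w + RtoC s * d)%C)) t (snd (l * d)%C).
Proof.
intros H.
assert (K : forall eps, 0 < eps -> exists e, 0 < e /\ forall y, Rabs (y - t) < e ->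
  Cmod (k (w + RtoC y * d)%C - k (w + RtoC t * d)%C - l * d * RtoC (y - t))%C <= eps * Rabs (y - t)).
{ intros eps He. pose proof (Cmod_ge_0 d) as Hd.
  assert (H1 : 0 < / (Cmod d + 1)) by (apply Rinv_0_lt_compat; lra).
  assert (H2 : Cmod d * / (Cmod d + 1) <= 1).
  { apply Rmult_le_reg_r with (Cmod d + 1); [lra|]. rewrite Rmult_assoc, Rinv_l; lra. }
  pose proof (cderiv_elim _ _ _ H (eps * / (Cmod d + 1)) (Rmult_lt_0_compat _ _ He H1)) as L.
  apply locally_C_iff in L. destruct L as [e [He' L]].
  exists (e * / (Cmod d + 1)); split; [apply Rmult_lt_0_compat; auto|].
  intros y Hy.
  assert (E : ((w + RtoC y * d) - (w + RtoC t * d))%C = (RtoC (y - t) * d)%C)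
    by (rewrite RtoC_minus; ring).
  specialize (L (w + RtoC y * d)%C). rewrite E, Cmod_mult, Cmod_R in L.
  replace (l * d * RtoC (y - t))%C with (l * (RtoC (y - t) * d))%C by ring.
  pose proof (Rabs_pos (y - t)) as Hp.
  eapply Rle_trans; [apply L|].
  - apply Rle_lt_trans with (Rabs (y - t) * (Cmod d + 1)); [apply Rmult_le_compat_l; lra|].
    apply Rmult_lt_reg_r with (1 := H1). rewrite Rmult_assoc, Rinv_r by lra. lra.
  - replace (eps * / (Cmod d + 1) * (Rabs (y - t) * Cmod d)) with (eps * Rabs (y - t) * (Cmod d * / (Cmod d + 1))) by ring.
    rewrite <- (Rmult_1_r (eps * Rabs (y - t))) at 2.
    apply Rmult_le_compat_l; [apply Rmult_le_pos; lra|lra]. }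
split; apply is_derive_eps; intros eps He; destruct (K eps He) as [e [He' L]];
  exists e; split; auto; intros y Hy; apply Rle_trans with (2 := L y Hy);
  [eapply Rle_trans; [|apply Rabs_fst_le_Cmod]|eapply Rle_trans; [|apply Rabs_snd_le_Cmod]];
  right; f_equal; simpl; ring.
Qed.

Lemma cderiv_dx (k : C -> C) (x y : R) (l : C) : cderiv k (x, y) l ->
  is_derive (fun s => fst (k (s, y))) x (fst l) /\
  is_derive (fun s => snd (k (s, y))) x (snd l).
Proof.
intros H.
assert (E : forall s : R, ((s, y) : C) = ((0, y) + RtoC s * 1)%C) by (intros; apply C_ext; simpl; ring).
rewrite (E x) in H. apply cderiv_line in H. rewrite Cmult_1_r in H.
destruct H as [H1 H2]; split;
 (eapply is_derive_ext; [|eassumption]); intros s; simpl; rewrite <- E; reflexivity.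
Qed.

Lemma cderiv_dy (k : C -> C) (x y : R) (l : C) : cderiv k (x, y) l ->
  is_derive (fun s => fst (k (x, s))) y (- snd l) /\
  is_derive (fun s => snd (k (x, s))) y (fst l).
Proof.
intros H.
assert (E : forall s : R, ((x, s) : C) = ((x, 0) + RtoC s * Ci)%C) by (intros; apply C_ext; simpl; ring).
rewrite (E y) in H. apply cderiv_line in H.
destruct H as [H1 H2]; split;
 (eapply is_derive_ext; [intros s; rewrite E; reflexivity|]);
 [replace (- snd l) with (fst (l * Ci)%C) by (simpl; ring)
 |replace (fst l) with (snd (l * Ci)%C) by (simpl; ring)]; assumption.
Qed.

Definition CInt (f : R -> C) (a b : R) : C :=
  (RInt (fun t => fst (f t)) a b, RInt (fun t => snd (f t)) a b).

Definition ccont_on (f : R -> C) (a b : R) : Prop :=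
  forall t, a <= t <= b -> continuous (U := C_UniformSpace) f t.

Lemma ccont_on_sub f a b c d : ccont_on f a b -> a <= c -> d <= b -> ccont_on f c d.
Proof. intros H ? ? t Ht; apply H; lra. Qed.

Lemma ccont_on_int f a b : a <= b -> ccont_on f a b ->
  ex_RInt (fun t => fst (f t)) a b /\ ex_RInt (fun t => snd (f t)) a b.
Proof.
intros Hab H; split; apply (ex_RInt_continuous (V := R_CompleteNormedModule));
  rewrite Rmin_left, Rmax_right by lra; intros t Ht; [apply ccont_fst|apply ccont_snd]; auto.
Qed.

Lemma CInt_ext f g a b : a <= b -> (forall t, a <= t <= b -> f t = g t) -> CInt f a b = CInt g a b.
Proof.
intros Hab H; unfold CInt; f_equal; apply RInt_ext; intros t;
  rewrite Rmin_left, Rmax_right by lra; intros Ht; rewrite H by lra; reflexivity.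
Qed.

Lemma CInt_plus f g a b : a <= b -> ccont_on f a b -> ccont_on g a b ->
  CInt (fun t => f t + g t)%C a b = (CInt f a b + CInt g a b)%C.
Proof.
intros Hab Hf Hg. destruct (ccont_on_int f a b Hab Hf), (ccont_on_int g a b Hab Hg).
apply C_ext; simpl; apply (RInt_plus (V := R_CompleteNormedModule)); auto.
Qed.

Lemma CInt_scal (c : C) f a b : a <= b -> ccont_on f a b ->
  CInt (fun t => c * f t)%C a b = (c * CInt f a b)%C.
Proof.
intros Hab Hf. destruct (ccont_on_int f a b Hab Hf) as [H1 H2].
assert (S : forall x g, ex_RInt g a b -> RInt (fun t => x * g t) a b = x * RInt g a b)
  by (intros; apply (RInt_scal (V := R_CompleteNormedModule)); auto).
assert (S' : forall x g, ex_RInt g a b -> ex_RInt (fun t => x * g t) a b)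
  by (intros; apply (ex_RInt_scal (V := R_NormedModule)); auto).
apply C_ext; simpl; rewrite <- !S by auto;
 [apply (RInt_minus (V := R_CompleteNormedModule))|apply (RInt_plus (V := R_CompleteNormedModule))]; auto.
Qed.

Lemma CInt_const (c : C) a b : CInt (fun _ => c) a b = (RtoC (b - a) * c)%C.
Proof.
unfold CInt; rewrite !(RInt_const (V := R_CompleteNormedModule)).
apply C_ext; simpl; unfold scal; simpl; unfold mult; simpl; ring.
Qed.

Lemma CInt_minus f g a b : a <= b -> ccont_on f a b -> ccont_on g a b ->
  CInt (fun t => f t - g t)%C a b = (CInt f a b - CInt g a b)%C.
Proof.
intros Hab Hf Hg. destruct (ccont_on_int f a b Hab Hf), (ccont_on_int g a b Hab Hg).
apply C_ext; simpl; apply (RInt_minus (V := R_CompleteNormedModule)); auto.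
Qed.

Lemma CInt_Chasles f a b c : a <= b -> b <= c -> ccont_on f a c ->
  CInt f a c = (CInt f a b + CInt f b c)%C.
Proof.
intros Hab Hbc H.
destruct (ccont_on_int f a b Hab (ccont_on_sub f a c a b H ltac:(lra) ltac:(lra))).
destruct (ccont_on_int f b c Hbc (ccont_on_sub f a c b c H ltac:(lra) ltac:(lra))).
apply C_ext; simpl; symmetry; apply (RInt_Chasles (V := R_CompleteNormedModule)); auto.
Qed.

Lemma CInt_bound f g a b : a <= b -> ccont_on f a b -> ex_RInt g a b ->
  (forall t, a <= t <= b -> Cmod (f t) <= g t) -> Cmod (CInt f a b) <= RInt g a b.
Proof.
intros Hab Hf Hg Hb. destruct (ccont_on_int f a b Hab Hf) as [H1 H2].
rewrite Cmod_norm.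
apply (norm_RInt_le (V := C_R_NormedModule) f g a b).
- exact Hab.
- intros t Ht. change (norm (f t : C_R_NormedModule) <= g t). rewrite <- Cmod_norm; auto.
- apply (is_RInt_fct_extend_pair (U := R_NormedModule) (V := R_NormedModule));
  apply (RInt_correct (V := R_CompleteNormedModule)); auto.
- apply (RInt_correct (V := R_CompleteNormedModule)); auto.
Qed.

Lemma CInt_bound_const f M a b : a <= b -> ccont_on f a b ->
  (forall t, a <= t <= b -> Cmod (f t) <= M) -> Cmod (CInt f a b) <= M * (b - a).
Proof.
intros Hab Hf Hb.
replace (M * (b - a)) with (RInt (fun _ => M) a b).
apply CInt_bound; auto. apply ex_RInt_const.
rewrite (RInt_const (V := R_CompleteNormedModule)); unfold scal; simpl; unfold mult; simpl; ring.
Qed.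

Lemma CInt_FTC_dx (P k : C -> C) a b y : a <= b ->
  (forall x, a <= x <= b -> cderiv P (x, y) (k (x, y))) ->
  ccont_on (fun x => k (x, y)) a b ->
  CInt (fun x => k (x, y)) a b = (P (b, y) - P (a, y))%C.
Proof.
intros Hab HP Hk. apply C_ext; simpl;
 apply is_RInt_unique; [apply (is_RInt_derive (fun x => fst (P (x, y))) (fun x => fst (k (x, y))))|
 apply (is_RInt_derive (fun x => snd (P (x, y))) (fun x => snd (k (x, y))))];
 rewrite Rmin_left, Rmax_right by lra; intros x Hx;
 solve [apply cderiv_dx, HP, Hx | apply (ccont_fst _ _ (Hk x Hx)) | apply (ccont_snd _ _ (Hk x Hx))].
Qed.

Lemma CInt_FTC_dy (P k : C -> C) a b x : a <= b ->
  (forall y, a <= y <= b -> cderiv P (x, y) (k (x, y))) ->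
  ccont_on (fun y => k (x, y)) a b ->
  (Ci * CInt (fun y => k (x, y)) a b)%C = (P (x, b) - P (x, a))%C.
Proof.
intros Hab HP Hk.
assert (E1 : is_RInt (fun y => snd (k (x, y))) a b (- (fst (P (x, b)) - fst (P (x, a))))).
{ replace (- (fst (P (x, b)) - fst (P (x, a)))) with ((- fst (P (x, b))) - (- fst (P (x, a)))) by ring.
  apply (is_RInt_derive (fun y => - fst (P (x, y))) (fun y => snd (k (x, y))));
  rewrite Rmin_left, Rmax_right by lra; intros y Hy; [|apply (ccont_snd _ _ (Hk y Hy))].
  rewrite <- (Ropp_involutive (snd (k (x, y)))).
  apply (is_derive_opp (fun y => fst (P (x, y)))), cderiv_dy, HP, Hy. }
assert (E2 : is_RInt (fun y => fst (k (x, y))) a b (snd (P (x, b)) - snd (P (x, a)))).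
{ apply (is_RInt_derive (fun y => snd (P (x, y))) (fun y => fst (k (x, y))));
  rewrite Rmin_left, Rmax_right by lra; intros y Hy; [|apply (ccont_fst _ _ (Hk y Hy))].
  apply cderiv_dy, HP, Hy. }
apply (is_RInt_unique (V := R_CompleteNormedModule)) in E1, E2.
apply C_ext; simpl; simpl in E1, E2; rewrite E1, E2; ring.
Qed.

(** * Goursat's theorem for rectangles *)

(** Bisection behind Goursat's theorem, for a size [e a c s] attached to the
    rectangle with corner [(a, c)] and sides [X s], [Y s].  If [e] is
    subadditive under quartering and [o(s^2)] at each point, then repeatedly
    choosing a quarter that carries at least a fourth of the size leads to a
    limit point at which [o(s^2)] fails if the initial size is positive. *)
Lemma quartering (X Y a0 c0 : R) (e : R -> R -> R -> R) :
  0 <= X -> 0 <= Y ->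
  let inside a c s := a0 <= a /\ a + X * s <= a0 + X /\ c0 <= c /\ c + Y * s <= c0 + Y in
  (forall a c s, 0 < s -> inside a c (2 * s) ->
     e a c (2 * s) <= e a c s + e (a + X * s) c s + e a (c + Y * s) s
                      + e (a + X * s) (c + Y * s) s) ->
  (forall u v, a0 <= u <= a0 + X -> c0 <= v <= c0 + Y ->
     forall eps, 0 < eps -> exists d, 0 < d /\ forall a c s, 0 < s < d -> inside a c s ->
       a <= u <= a + X * s -> c <= v <= c + Y * s -> e a c s <= eps * s ^ 2) ->
  e a0 c0 1 <= 0.
Proof.
intros HX HY inside Hsub Hloc.
destruct (Rle_lt_dec (e a0 c0 1) 0) as [|Hk]; auto. exfalso.
set (k := e a0 c0 1) in *.
(* the first quarter carrying at least a fourth; by elimination the last one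
   does when the first three do not *)
pose (nxt := fun (s : R) (p : R * R) => let (a, c) := p in
  let q := e a c (2 * s) / 4 in
  if Rle_dec q (e a c s) then (a, c)
  else if Rle_dec q (e (a + X * s) c s) then (a + X * s, c)
  else if Rle_dec q (e a (c + Y * s) s) then (a, c + Y * s)
  else (a + X * s, c + Y * s)).
pose (sq := fix sq (n : nat) : R * R :=
  match n with O => (a0, c0) | S n => nxt ((/ 2) ^ S n) (sq n) end).
pose (s := fun n : nat => (/ 2) ^ n).
assert (Hs : forall n, 0 < s n) by (intros; apply pow_lt; lra).
assert (HsS : forall n, s n = 2 * s (S n)) by (intros; unfold s; simpl; field).
assert (Step : forall n, inside (fst (sq n)) (snd (sq n)) (s n) ->
   inside (fst (sq (S n))) (snd (sq (S n))) (s (S n)) /\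
   fst (sq n) <= fst (sq (S n)) /\ fst (sq (S n)) + X * s (S n) <= fst (sq n) + X * s n /\
   snd (sq n) <= snd (sq (S n)) /\ snd (sq (S n)) + Y * s (S n) <= snd (sq n) + Y * s n /\
   e (fst (sq n)) (snd (sq n)) (s n) / 4 <= e (fst (sq (S n))) (snd (sq (S n))) (s (S n))).
{ intros n. change (sq (S n)) with (nxt (s (S n)) (sq n)).
  destruct (sq n) as [a c]; change (fst (a, c)) with a; change (snd (a, c)) with c.
  rewrite (HsS n). pose proof (Hs (S n)) as H0. generalize dependent (s (S n)). intros t Ht Hin.
  pose proof (Hsub a c t Ht Hin) as H4.
  assert (0 <= X * t) by (apply Rmult_le_pos; lra).
  assert (0 <= Y * t) by (apply Rmult_le_pos; lra).
  unfold inside in *. unfold nxt.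
  repeat destruct Rle_dec; simpl; repeat split; lra. }
assert (Inv : forall n, inside (fst (sq n)) (snd (sq n)) (s n) /\ k * s n ^ 2 <= e (fst (sq n)) (snd (sq n)) (s n)).
{ induction n as [|n [I1 I2]].
  - simpl; unfold inside, s; simpl; fold k. repeat split; lra.
  - destruct (Step n I1) as (J1 & _ & _ & _ & _ & J2). split; auto.
    rewrite (HsS n) in I2 at 1. nra. }
assert (Mono : forall m n, (m <= n)%nat -> fst (sq m) <= fst (sq n) /\ fst (sq n) + X * s n <= fst (sq m) + X * s m
   /\ snd (sq m) <= snd (sq n) /\ snd (sq n) + Y * s n <= snd (sq m) + Y * s m).
{ intros m n Hmn; induction Hmn as [|n Hmn IH]; [lra|].
  destruct (Step n (proj1 (Inv n))) as (_ & ? & ? & ? & ? & _). lra. }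
assert (HXs : forall n, 0 <= X * s n) by (intros; apply Rmult_le_pos; auto; left; auto).
assert (HYs : forall n, 0 <= Y * s n) by (intros; apply Rmult_le_pos; auto; left; auto).
assert (Nest : forall m n, fst (sq n) <= fst (sq m) + X * s m /\ snd (sq n) <= snd (sq m) + Y * s m).
{ intros m n. destruct (Nat.le_ge_cases m n) as [H|H]; apply Mono in H;
  pose proof (HXs n); pose proof (HXs m); pose proof (HYs n); pose proof (HYs m); lra. }
destruct (completeness (fun x => exists n, x = fst (sq n))) as [u [Hu1 Hu2]].
{ exists (a0 + X). intros x [n ->]. destruct (Nest 0%nat n) as [Hn _]. unfold s in Hn; simpl in Hn; lra. }
{ exists a0, 0%nat; reflexivity. }
destruct (completeness (fun x => exists n, x = snd (sq n))) as [v [Hv1 Hv2]].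
{ exists (c0 + Y). intros x [n ->]. destruct (Nest 0%nat n) as [_ Hn]. unfold s in Hn; simpl in Hn; lra. }
{ exists c0, 0%nat; reflexivity. }
assert (Hu : forall n, fst (sq n) <= u <= fst (sq n) + X * s n).
{ intros n; split; [apply Hu1; eauto|]. apply Hu2. intros x [m ->]. apply Nest. }
assert (Hv : forall n, snd (sq n) <= v <= snd (sq n) + Y * s n).
{ intros n; split; [apply Hv1; eauto|]. apply Hv2. intros x [m ->]. apply Nest. }
destruct (Hloc u v) with (eps := k / 2) as [d [Hd Hb]]; [| |lra|].
{ specialize (Hu 0%nat). unfold s in Hu; simpl in Hu; lra. }
{ specialize (Hv 0%nat). unfold s in Hv; simpl in Hv; lra. }
destruct (pow_lt_1_zero (/ 2)) with (y := d) as [N HN]; [rewrite Rabs_right; lra|lra|].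
specialize (HN N (le_n _)). rewrite Rabs_right in HN by (apply Rle_ge; left; apply (Hs N)).
destruct (Inv N) as [I1 I2].
specialize (Hb _ _ (s N) (conj (Hs N) HN) I1 (Hu N) (Hv N)).
assert (0 < k * s N ^ 2) by (apply Rmult_lt_0_compat; [exact Hk|apply pow_lt, Hs]).
lra.
Qed.

(** The contour integral of [k] along the boundary of [[a, b] x [c, d]]. *)
Definition rectint (k : C -> C) (a b c d : R) : C :=
  (CInt (fun x => k (x, c)) a b - CInt (fun x => k (x, d)) a b
   + Ci * (CInt (fun y => k (b, y)) c d - CInt (fun y => k (a, y)) c d))%C.

Definition ccont_rect (k : C -> C) (a b c d : R) : Prop :=
  forall x y, a <= x <= b -> c <= y <= d ->
    ccontinuous k (x, y).

Lemma ccont_horiz k (x y : R) :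
  ccontinuous k (x, y) ->
  continuous (U := C_UniformSpace) (fun s => k (s, y)) x.
Proof.
intros H. apply (continuous_comp (fun s => ((s, y) : C)) k); [|exact H].
apply ccont_pair; [apply continuous_id|apply continuous_const].
Qed.

Lemma ccont_vert k (x y : R) :
  ccontinuous k (x, y) ->
  continuous (U := C_UniformSpace) (fun s => k (x, s)) y.
Proof.
intros H. apply (continuous_comp (fun s => ((x, s) : C)) k); [|exact H].
apply ccont_pair; [apply continuous_const|apply continuous_id].
Qed.

Lemma ccont_rect_on k a b c d : ccont_rect k a b c d ->
  (forall y, c <= y <= d -> ccont_on (fun x => k (x, y)) a b) /\
  (forall x, a <= x <= b -> ccont_on (fun y => k (x, y)) c d).
Proof.
intros H; split; intros ? ? ? ?; [apply ccont_horiz|apply ccont_vert]; apply H; auto.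
Qed.

Lemma rectint_split k a m b c n d :
  a <= m <= b -> c <= n <= d -> ccont_rect k a b c d ->
  rectint k a b c d = (rectint k a m c n + rectint k m b c n + rectint k a m n d + rectint k m b n d)%C.
Proof.
intros Hm Hn Hk. destruct (ccont_rect_on _ _ _ _ _ Hk) as [Hx Hy].
unfold rectint.
rewrite (CInt_Chasles (fun x => k (x, c)) a m b), (CInt_Chasles (fun x => k (x, d)) a m b),
  (CInt_Chasles (fun y => k (b, y)) c n d), (CInt_Chasles (fun y => k (a, y)) c n d);
  try apply Hx; try apply Hy; try lra.
ring.
Qed.

Lemma rectint_plus k g a b c d : a <= b -> c <= d ->
  ccont_rect k a b c d -> ccont_rect g a b c d ->
  rectint (fun w => k w + g w)%C a b c d = (rectint k a b c d + rectint g a b c d)%C.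
Proof.
intros Hab Hcd Hk Hg.
destruct (ccont_rect_on _ _ _ _ _ Hk) as [Hx Hy].
destruct (ccont_rect_on _ _ _ _ _ Hg) as [Hx' Hy'].
unfold rectint.
rewrite (CInt_plus (fun x => k (x, c)) (fun x => g (x, c))),
  (CInt_plus (fun x => k (x, d)) (fun x => g (x, d))),
  (CInt_plus (fun x => k (a, x)) (fun x => g (a, x))),
  (CInt_plus (fun x => k (b, x)) (fun x => g (b, x)));
  try apply Hx; try apply Hy; try apply Hx'; try apply Hy'; try lra.
ring.
Qed.

Lemma rectint_ext k g a b c d : a <= b -> c <= d -> (forall w, k w = g w) ->
  rectint k a b c d = rectint g a b c d.
Proof.
intros Hab Hcd H. unfold rectint.
rewrite (CInt_ext (fun x => k (x, c)) (fun x => g (x, c))),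
  (CInt_ext (fun x => k (x, d)) (fun x => g (x, d))),
  (CInt_ext (fun y => k (a, y)) (fun y => g (a, y))),
  (CInt_ext (fun y => k (b, y)) (fun y => g (b, y))); auto.
Qed.

Lemma rectint_primitive P k a b c d : a <= b -> c <= d ->
  ccont_rect k a b c d -> (forall w, cderiv P w (k w)) -> rectint k a b c d = 0%C.
Proof.
intros Hab Hcd Hk HP. destruct (ccont_rect_on _ _ _ _ _ Hk) as [Hx Hy].
unfold rectint.
rewrite (CInt_FTC_dx P k a b c), (CInt_FTC_dx P k a b d); auto; try (apply Hx; lra).
unfold Cminus at 4. rewrite Cmult_plus_distr_l.
replace (Ci * - CInt (fun y => k (a, y)) c d)%C with (- (Ci * CInt (fun y => k (a, y)) c d))%C by ring.
rewrite (CInt_FTC_dy P k c d a), (CInt_FTC_dy P k c d b); auto; try (apply Hy; lra).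
ring.
Qed.

Lemma rectint_bound k M a b c d : a <= b -> c <= d -> ccont_rect k a b c d ->
  (forall x y, a <= x <= b -> c <= y <= d -> Cmod (k (x, y)) <= M) ->
  Cmod (rectint k a b c d) <= M * (2 * (b - a + (d - c))).
Proof.
intros Hab Hcd Hk HM. destruct (ccont_rect_on _ _ _ _ _ Hk) as [Hx Hy].
pose proof (CInt_bound_const (fun x => k (x, c)) M a b Hab (Hx c ltac:(lra)) (fun x H => HM x c H ltac:(lra))).
pose proof (CInt_bound_const (fun x => k (x, d)) M a b Hab (Hx d ltac:(lra)) (fun x H => HM x d H ltac:(lra))).
pose proof (CInt_bound_const (fun y => k (a, y)) M c d Hcd (Hy a ltac:(lra)) (fun y H => HM a y ltac:(lra) H)).
pose proof (CInt_bound_const (fun y => k (b, y)) M c d Hcd (Hy b ltac:(lra)) (fun y H => HM b y ltac:(lra) H)).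
unfold rectint. unfold Cminus.
eapply Rle_trans; [apply Cmod_triangle|]. rewrite Cmod_mult, Cmod_Ci.
pose proof (Cmod_triangle (CInt (fun x => k (x, c)) a b) (- CInt (fun x => k (x, d)) a b)) as T1.
pose proof (Cmod_triangle (CInt (fun x => k (b, x)) c d) (- CInt (fun x => k (a, x)) c d)) as T2.
rewrite Cmod_opp in T1, T2. lra.
Qed.

(** Near a point the affine part of [k] has a primitive and contributes nothing,
    and the remainder is [o(s)] along a contour of length [O(s)]. *)
Lemma goursat (k : C -> C) (a0 b0 c0 d0 : R) : a0 <= b0 -> c0 <= d0 ->
  (forall x y, a0 <= x <= b0 -> c0 <= y <= d0 -> exists l, cderiv k (x, y) l) ->
  rectint k a0 b0 c0 d0 = 0%C.
Proof.
intros Hab Hcd Hk.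
assert (Hc : ccont_rect k a0 b0 c0 d0).
{ intros x y Hx Hy. destruct (Hk x y Hx Hy) as [l Hl]. exact (cderiv_cont _ _ _ Hl). }
set (X := b0 - a0). set (Y := d0 - c0).
assert (HX : 0 <= X) by (unfold X; lra). assert (HY : 0 <= Y) by (unfold Y; lra).
apply Cmod_eq_0, Rle_antisym; [|apply Cmod_ge_0].
pose (e := fun a c s => Cmod (rectint k a (a + X * s) c (c + Y * s))).
replace (Cmod (rectint k a0 b0 c0 d0)) with (e a0 c0 1)
  by (unfold e, X, Y; f_equal; f_equal; ring).
apply (quartering X Y a0 c0 e HX HY).
- intros a c s Hs (I1 & I2 & I3 & I4).
  assert (0 <= X * s) by (apply Rmult_le_pos; lra).
  assert (0 <= Y * s) by (apply Rmult_le_pos; lra).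
  unfold e.
  rewrite (rectint_split k a (a + X * s) (a + X * (2 * s)) c (c + Y * s) (c + Y * (2 * s))); try lra.
  2: intros x y Hx Hy; apply Hc; unfold X, Y in *; lra.
  replace (a + X * (2 * s)) with (a + X * s + X * s) by ring.
  replace (c + Y * (2 * s)) with (c + Y * s + Y * s) by ring.
  eapply Rle_trans; [apply Cmod_triangle|]. apply Rplus_le_compat_r.
  eapply Rle_trans; [apply Cmod_triangle|]. apply Rplus_le_compat_r.
  apply Cmod_triangle.
- intros u v Hu Hv eps He.
  destruct (Hk u v) as [l Hl]; [unfold X in *; lra|unfold Y in *; lra|].
  set (D := 2 * (X + Y) * (X + Y) + 1).
  assert (HD : 0 < D) by (unfold D; nra).
  destruct (proj1 (locally_C_iff _ _) (cderiv_elim _ _ _ Hl (eps / D) ltac:(apply Rdiv_lt_0_compat; lra))) as [r [Hr Hb]].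
  exists (r / (X + Y + 1)); split; [apply Rdiv_lt_0_compat; lra|].
  intros a c s [Hs Hsr] (I1 & I2 & I3 & I4) Hau Hcv.
  assert (HXs : 0 <= X * s) by (apply Rmult_le_pos; lra).
  assert (HYs : 0 <= Y * s) by (apply Rmult_le_pos; lra).
  (* [k = A + rem], where [A] is the affine part at [(u, v)] and [P] a primitive of
     [A] *)
  set (A := fun w : C => (k (u, v) + l * (w - (u, v)))%C).
  set (rem := fun w : C => (k w - A w)%C).
  set (P := fun w : C => (k (u, v) * w + l * ((w - (u, v)) * (w - (u, v))) * / 2)%C).
  assert (HP : forall w, cderiv P w (A w)).
  { intros w.
    assert (Hd : cderiv (fun w => w - (u, v))%C w 1%C).
    { replace (RtoC 1) with (1 - 0)%C by ring. apply cderiv_minus; [apply cderiv_id|apply cderiv_const]. }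
    replace (A w) with ((0 * w + k (u, v) * 1) +
       ((0 * ((w - (u, v)) * (w - (u, v))) + l * (1 * (w - (u, v)) + (w - (u, v)) * 1)) * / 2
        + l * ((w - (u, v)) * (w - (u, v))) * 0))%C.
    2: { unfold A. field. }
    apply cderiv_plus; [apply (cderiv_mult (fun _ => k (u, v)) (fun w => w)); [apply cderiv_const|apply cderiv_id]|].
    apply (cderiv_mult (fun w => l * ((w - (u, v)) * (w - (u, v))))%C (fun _ => / 2)%C); [|apply cderiv_const].
    apply (cderiv_mult (fun _ => l) (fun w => (w - (u, v)) * (w - (u, v)))%C); [apply cderiv_const|].
    apply (cderiv_mult (fun w => w - (u, v))%C (fun w => w - (u, v))%C); exact Hd. }
  assert (CA : ccont_rect A a (a + X * s) c (c + Y * s)).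
  { intros x y _ _. unfold A. apply ccont_plus; [apply continuous_const|].
    apply ccont_mult; [apply continuous_const|]. apply ccont_minus; [apply continuous_id|apply continuous_const]. }
  assert (Ck : ccont_rect k a (a + X * s) c (c + Y * s)).
  { intros x y Hx Hy. apply Hc; unfold X, Y in *; lra. }
  assert (CR : ccont_rect rem a (a + X * s) c (c + Y * s)).
  { intros x y Hx Hy. unfold rem. apply ccont_minus; [apply Ck|apply CA]; auto. }
  unfold e.
  assert (E : rectint k a (a + X * s) c (c + Y * s) = rectint rem a (a + X * s) c (c + Y * s)).
  { transitivity (rectint (fun w => A w + rem w)%C a (a + X * s) c (c + Y * s)).
    - apply rectint_ext; try lra. intros w; unfold rem; ring.
    - rewrite rectint_plus by (auto; lra).
      rewrite (rectint_primitive P A); auto; try lra. ring. }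
  rewrite E.
  eapply Rle_trans; [apply (rectint_bound rem (eps / D * ((X + Y) * s))); auto; try lra|].
  + intros x y Hx Hy.
    assert (Hw : Cmod ((x, y) - (u, v))%C <= (X + Y) * s).
    { eapply Rle_trans; [apply Cmod_le_sum|]. simpl.
      assert (Rabs (x + - u) <= X * s) by (apply Rabs_le; lra).
      assert (Rabs (y + - v) <= Y * s) by (apply Rabs_le; lra). lra. }
    unfold rem, A. replace (k (x, y) - (k (u, v) + l * ((x, y) - (u, v))))%C
      with (k (x, y) - k (u, v) - l * ((x, y) - (u, v)))%C by ring.
    eapply Rle_trans; [apply Hb|].
    * apply Rle_lt_trans with (1 := Hw).
      apply Rlt_le_trans with ((X + Y + 1) * (r / (X + Y + 1))); [|right; field; lra].
      apply Rle_lt_trans with ((X + Y + 1) * s); [nra|apply Rmult_lt_compat_l; lra].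
    * apply Rmult_le_compat_l; [left; apply Rdiv_lt_0_compat; lra|auto].
  + replace (eps / D * ((X + Y) * s) * (2 * (a + X * s - a + (c + Y * s - c))))
      with (eps * s ^ 2 * ((2 * (X + Y) * (X + Y)) / D)) by (field; lra).
    rewrite <- (Rmult_1_r (eps * s ^ 2)) at 2. apply Rmult_le_compat_l; [apply Rmult_le_pos; [lra|apply pow2_ge_0]|].
    apply Rmult_le_reg_r with (1 := HD). unfold Rdiv. rewrite Rmult_assoc, Rinv_l by lra. unfold D; lra.
Qed.

(** * Logarithmic coordinates and circle integrals *)

Lemma is_derive_elim (f : R -> R) (x l : R) : is_derive f x l ->
  forall eps, 0 < eps -> exists d, 0 < d /\ forall y, Rabs (y - x) < d ->
     Rabs (f y - f x - l * (y - x)) <= eps * Rabs (y - x).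
Proof.
intros [_ H] eps He.
destruct (H x (fun P HP => HP) (mkposreal eps He)) as [d Hd].
exists d; split; [apply cond_pos|]. intros y Hy. specialize (Hd y Hy).
replace (f y - f x - l * (y - x)) with (f y - f x - (y - x) * l) by ring. exact Hd.
Qed.

(** [circ x y] is [e^(x + i y)]: the circle of radius [e^x] is a vertical segment
    in the logarithmic coordinates [(x, y)]. *)
Definition circ (x y : R) : C := (exp x * cos y, exp x * sin y).
Definition cexp (w : C) : C := circ (fst w) (snd w).

Lemma Cmod_circ x y : Cmod (circ x y) = exp x.
Proof.
unfold Cmod, circ; simpl.
replace (exp x * cos y * (exp x * cos y * 1) + exp x * sin y * (exp x * sin y * 1))
  with (exp x * exp x * (Rsqr (sin y) + Rsqr (cos y))) by (unfold Rsqr; ring).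
rewrite sin2_cos2, Rmult_1_r. apply sqrt_square. left; apply exp_pos.
Qed.

Lemma cexp_plus a b : cexp (a + b)%C = (cexp a * cexp b)%C.
Proof.
unfold cexp, circ; apply C_ext; simpl; rewrite exp_plus, ?cos_plus, ?sin_plus; ring.
Qed.

Lemma cexp_deriv0 eps : 0 < eps -> exists d, 0 < d /\ forall w : C, Cmod w < d ->
  Cmod (cexp w - 1 - w)%C <= eps * Cmod w.
Proof.
intros He0. set (e := Rmin (eps / 10) 1).
assert (He : 0 < e) by (unfold e; apply Rmin_glb_lt; lra).
assert (Hee : 10 * e <= eps) by (unfold e; pose proof (Rmin_l (eps / 10) 1); lra).
assert (He1 : e <= 1) by apply Rmin_r.
assert (D1 : is_derive exp 0 1) by (auto_derive; auto; rewrite exp_0; ring).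
assert (D2 : is_derive cos 0 0) by (auto_derive; auto; rewrite sin_0; ring).
assert (D3 : is_derive sin 0 1) by (auto_derive; auto; rewrite cos_0; ring).
destruct (is_derive_elim _ _ _ D1 e He) as [d1 [Hd1 B1]].
destruct (is_derive_elim _ _ _ D2 e He) as [d2 [Hd2 B2]].
destruct (is_derive_elim _ _ _ D3 e He) as [d3 [Hd3 B3]].
rewrite exp_0 in B1. rewrite cos_0 in B2. rewrite sin_0 in B3.
set (d := Rmin (Rmin d1 (Rmin d2 d3)) (e / 2)).
assert (Hd : d <= d1 /\ d <= d2 /\ d <= d3 /\ d <= e / 2).
{ unfold d; repeat (unfold Rmin; destruct Rle_dec); lra. }
exists d; split. { unfold d; repeat apply Rmin_glb_lt; lra. }
intros [x y] Hw.
pose proof (Rabs_fst_le_Cmod (x, y)) as Hx. pose proof (Rabs_snd_le_Cmod (x, y)) as Hy. simpl in Hx, Hy.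
set (m := Cmod (x, y)) in *.
specialize (B1 x). specialize (B2 y). specialize (B3 y).
rewrite ?Rminus_0_r, ?Rmult_0_l, ?Rmult_1_l, ?Rminus_0_r in *.
specialize (B1 ltac:(lra)). specialize (B2 ltac:(lra)). specialize (B3 ltac:(lra)).
assert (Hm : 0 <= m) by apply Cmod_ge_0.
pose proof (Rabs_pos x) as Px. pose proof (Rabs_pos y) as Py.
assert (K1 : Rabs (exp x - 1 - x) <= e * m) by (apply Rle_trans with (1 := B1); apply Rmult_le_compat_l; lra).
assert (K2 : Rabs (cos y - 1) <= e * m) by (apply Rle_trans with (1 := B2); apply Rmult_le_compat_l; lra).
assert (K3 : Rabs (sin y - y) <= e * m) by (apply Rle_trans with (1 := B3); apply Rmult_le_compat_l; lra).
assert (Em : e * m <= e / 2) by nra.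
assert (K4 : Rabs (exp x - 1) <= e).
{ replace (exp x - 1) with ((exp x - 1 - x) + x) by ring. eapply Rle_trans; [apply Rabs_triang|]. lra. }
assert (K5 : 0 < exp x <= 2).
{ split; [apply exp_pos|]. apply Rabs_le_between in K4. lra. }
eapply Rle_trans; [apply Cmod_le_sum|]. unfold cexp, circ; simpl.
replace (exp x * cos y + - (1) + - x) with ((exp x - 1 - x) + exp x * (cos y - 1)) by ring.
replace (exp x * sin y + - 0 + - y) with (exp x * (sin y - y) + (exp x - 1) * y) by ring.
assert (Rabs (exp x * (cos y - 1)) <= 2 * (e * m)).
{ rewrite Rabs_mult, (Rabs_right (exp x)) by lra. apply Rmult_le_compat; try apply Rabs_pos; lra. }
assert (Rabs (exp x * (sin y - y)) <= 2 * (e * m)).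
{ rewrite Rabs_mult, (Rabs_right (exp x)) by lra. apply Rmult_le_compat; try apply Rabs_pos; lra. }
assert (Rabs ((exp x - 1) * y) <= e * m).
{ rewrite Rabs_mult. apply Rmult_le_compat; try apply Rabs_pos; lra. }
pose proof (Rabs_triang (exp x - 1 - x) (exp x * (cos y - 1))).
pose proof (Rabs_triang (exp x * (sin y - y)) ((exp x - 1) * y)).
assert (10 * e * m <= eps * m) by (apply Rmult_le_compat_r; auto).
assert (0 <= e * m) by (apply Rmult_le_pos; lra).
lra.
Qed.

Lemma cexp_deriv w : cderiv cexp w (cexp w).
Proof.
apply cderiv_intro; intros eps He. apply locally_C_iff.
pose proof (exp_pos (fst w)) as Hp.
destruct (cexp_deriv0 (eps / exp (fst w)) ltac:(apply Rdiv_lt_0_compat; auto)) as [d [Hd B]].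
exists d; split; auto. intros v Hv. specialize (B (v - w)%C Hv).
assert (E : cexp v = (cexp w * cexp (v - w))%C) by (rewrite <- cexp_plus; f_equal; ring).
replace (cexp v - cexp w - cexp w * (v - w))%C with (cexp w * (cexp (v - w) - 1 - (v - w)))%C
  by (rewrite E; ring).
rewrite Cmod_mult. unfold cexp at 1. rewrite Cmod_circ.
replace (eps * Cmod (v - w)) with (exp (fst w) * (eps / exp (fst w) * Cmod (v - w)%C)) by (field; lra).
apply Rmult_le_compat_l; lra.
Qed.

Lemma circ_period x : circ x (2 * PI) = circ x 0.
Proof. unfold circ; rewrite cos_2PI, sin_2PI, cos_0, sin_0; reflexivity. Qed.

Lemma ccont_circ_y (q : C -> C) x y :
  ccontinuous q (circ x y) ->
  continuous (U := C_UniformSpace) (fun t => q (circ x t)) y.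
Proof.
intros H. apply (ccont_vert (fun w => q (cexp w))).
apply (continuous_comp cexp q); [|exact H].
apply (cderiv_cont _ _ _ (cexp_deriv _)).
Qed.

Definition circle_int (q : C -> C) (x : R) : C := CInt (fun y => q (circ x y)) 0 (2 * PI).

Lemma PI2_pos : 0 <= 2 * PI.
Proof. pose proof PI_RGT_0; lra. Qed.

(** In logarithmic coordinates an annulus is a rectangle whose horizontal sides
    cancel by periodicity. *)
Lemma circle_int_deform q x1 x2 : x1 <= x2 ->
  (forall z, exp x1 <= Cmod z <= exp x2 -> exists l, cderiv q z l) ->
  circle_int q x1 = circle_int q x2.
Proof.
intros H12 Hq.
pose proof (goursat (fun w => q (cexp w)) x1 x2 0 (2 * PI) H12 PI2_pos) as G.
assert (E : rectint (fun w => q (cexp w)) x1 x2 0 (2 * PI) = (Ci * (circle_int q x2 - circle_int q x1))%C).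
{ unfold rectint. rewrite (CInt_ext (fun x => q (cexp (x, 2 * PI))) (fun x => q (cexp (x, 0)))); auto.
  2: intros t _; unfold cexp; simpl; rewrite circ_period; auto.
  unfold circle_int, cexp; simpl. ring. }
rewrite E in G.
replace (circle_int q x1) with (circle_int q x2 + Ci * (Ci * (circle_int q x2 - circle_int q x1)))%C.
- rewrite G; [ring|]. intros x y Hx Hy.
  destruct (Hq (circ x y)) as [l Hl].
  { rewrite Cmod_circ. split; (destruct (Req_dec x x1) as [->|]; [|]); try lra;
     try (left; apply exp_increasing; lra).
    destruct H12 as [?| ->]; [left; apply exp_increasing; lra|lra].
    destruct (proj2 Hx) as [?| ->]; [left; apply exp_increasing; lra|lra]. }
  eexists. apply (cderiv_comp q cexp); [exact Hl|apply cexp_deriv].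
- assert (I : (Ci * Ci = -1)%C) by (apply C_ext; simpl; ring).
  rewrite Cmult_assoc, I. ring.
Qed.

(** * Mean value property and Cauchy's formula *)

Lemma Cminus_eq_0 (a b : C) : (a - b)%C = 0%C -> a = b.
Proof. intros E. replace a with (a - b + b)%C by ring. rewrite E; ring. Qed.

Definition disk_cont (q : C -> C) : Prop := forall z, Cmod z < 1 ->
  ccontinuous q z.

Lemma cont_2d (phi : C -> R) x y : continuous (T := C_UniformSpace) phi (x, y) ->
  continuity_2d_pt (fun u v => phi (u, v)) x y.
Proof.
intros H. apply continuity_2d_pt_filterlim.
change (continuous (T := prod_UniformSpace R_UniformSpace R_UniformSpace)
  (fun z : R * R => phi (fst z, snd z)) (x, y)).
apply (continuous_ext (T := prod_UniformSpace R_UniformSpace R_UniformSpace) phi); [intros [? ?]; reflexivity|exact H].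
Qed.

Lemma ccont_2d (q : C -> C) x y :
  ccontinuous q (x, y) ->
  continuity_2d_pt (fun u v => fst (q (u, v))) x y /\
  continuity_2d_pt (fun u v => snd (q (u, v))) x y.
Proof.
intros H; split; [apply (cont_2d (fun w => fst (q w))), ccont_fst, H
                 |apply (cont_2d (fun w => snd (q w))), ccont_snd, H].
Qed.

Lemma circle_cont_on q x : (forall z, Cmod z = exp x ->
    ccontinuous q z) -> forall a b, ccont_on (fun y => q (circ x y)) a b.
Proof. intros H a b t _. apply ccont_circ_y, H, Cmod_circ. Qed.

Lemma exp_lt_1 x : x < 0 -> exp x < 1.
Proof. intros H; rewrite <- exp_0; apply exp_increasing; auto. Qed.

Lemma circle_int_cont q x0 : disk_cont q -> x0 < 0 ->
  forall eps, 0 < eps -> exists d, 0 < d /\ forall x, Rabs (x - x0) < d ->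
    Cmod (circle_int q x - circle_int q x0)%C <= eps.
Proof.
intros Hq Hx0 eps He.
assert (Hc : forall y, ccontinuous (fun w => q (cexp w)) (x0, y)).
{ intros y. apply (continuous_comp cexp q); [apply (cderiv_cont _ _ _ (cexp_deriv _))|].
  apply Hq. unfold cexp; rewrite Cmod_circ; apply exp_lt_1; auto. }
pose proof PI_RGT_0 as Hpi.
assert (He' : 0 < eps / (4 * PI)) by (apply Rdiv_lt_0_compat; lra).
destruct (uniform_continuity_2d_1d' (fun u v => fst (q (cexp (u, v)))) 0 (2 * PI) x0
  (fun y _ => proj1 (ccont_2d _ _ _ (Hc y))) (mkposreal _ He')) as [d1 H1].
destruct (uniform_continuity_2d_1d' (fun u v => snd (q (cexp (u, v)))) 0 (2 * PI) x0
  (fun y _ => proj2 (ccont_2d _ _ _ (Hc y))) (mkposreal _ He')) as [d2 H2].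
exists (Rmin (Rmin d1 d2) (- x0)).
split. { repeat apply Rmin_glb_lt; try apply cond_pos; lra. }
intros x Hx.
assert (B : Rabs (x - x0) < d1 /\ Rabs (x - x0) < d2 /\ Rabs (x - x0) < - x0).
{ repeat split; apply Rlt_le_trans with (1 := Hx);
  [eapply Rle_trans; [apply Rmin_l|apply Rmin_l]|eapply Rle_trans; [apply Rmin_l|apply Rmin_r]|apply Rmin_r]. }
destruct B as (B1 & B2 & B3). apply Rabs_lt_between in B1, B2, B3.
assert (C1 : ccont_on (fun y => q (circ x y)) 0 (2 * PI)).
{ apply circle_cont_on; intros z Hz; apply Hq; rewrite Hz; apply exp_lt_1; lra. }
assert (C0 : ccont_on (fun y => q (circ x0 y)) 0 (2 * PI)).
{ apply circle_cont_on; intros z Hz; apply Hq; rewrite Hz; apply exp_lt_1; lra. }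
unfold circle_int. rewrite <- CInt_minus by (auto; apply PI2_pos).
replace eps with (eps / (2 * PI) * (2 * PI - 0)) by (field; lra).
apply CInt_bound_const; [apply PI2_pos| |].
{ intros t Ht; apply ccont_minus; [apply C1|apply C0]; auto. }
intros t Ht.
specialize (H1 t x0 t x Ht ltac:(lra) Ht ltac:(lra)). specialize (H2 t x0 t x Ht ltac:(lra) Ht ltac:(lra)).
rewrite Rminus_diag, Rabs_R0 in H1, H2.
specialize (H1 (cond_pos d1)). specialize (H2 (cond_pos d2)). simpl in H1, H2.
eapply Rle_trans; [apply Cmod_le_sum|]. simpl.
unfold cexp in H1, H2; simpl in H1, H2. unfold Rminus in H1, H2.
replace (eps / (2 * PI)) with (eps / (4 * PI) + eps / (4 * PI)) by (field; lra). lra.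
Qed.

(** An exceptional circle [|z| = r0], on which only continuity is known, does not
    affect the constancy: the integral is constant on both sides of it and
    continuous across it.  This is what allows difference quotients as
    integrands, for which differentiability at the base point is not known. *)
Lemma circle_int_const q r0 : disk_cont q ->
  (forall z, Cmod z < 1 -> Cmod z <> r0 -> exists l, cderiv q z l) ->
  forall x1 x2, x1 <= x2 -> x2 < 0 -> circle_int q x1 = circle_int q x2.
Proof.
intros Hc Hq.
assert (Good : forall x1 x2, x1 <= x2 -> x2 < 0 -> (exp x2 < r0 \/ r0 < exp x1) ->
   circle_int q x1 = circle_int q x2).
{ intros x1 x2 H12 H2 H. apply circle_int_deform; auto. intros z Hz.
  pose proof (exp_lt_1 x2 H2). apply Hq; lra. }
assert (Left : forall x, x < 0 -> exp x = r0 -> forall x1, x1 < x -> circle_int q x1 = circle_int q x).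
{ intros x Hx E x1 H1. apply Cminus_eq_0. apply Cmod_eq_0, Rle_antisym; [|apply Cmod_ge_0].
  apply le_epsilon; intros eps He. rewrite Rplus_0_l.
  destruct (circle_int_cont q x Hc Hx eps He) as [d [Hd B]].
  set (y := Rmax x1 (x - d / 2)).
  assert (Hy : x1 <= y < x /\ x - d / 2 <= y).
  { unfold y; split; [split; [apply Rmax_l|apply Rmax_lub_lt; lra]|apply Rmax_r]. }
  rewrite (Good x1 y); [apply B; apply Rabs_lt_between; lra|lra|lra|left].
  rewrite <- E; apply exp_increasing; lra. }
assert (Right : forall x, x < 0 -> exp x = r0 -> forall x2, x2 < 0 -> x < x2 -> circle_int q x = circle_int q x2).
{ intros x Hx E x2 H2 Hxx. symmetry. apply Cminus_eq_0. apply Cmod_eq_0, Rle_antisym; [|apply Cmod_ge_0].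
  apply le_epsilon; intros eps He. rewrite Rplus_0_l.
  destruct (circle_int_cont q x Hc Hx eps He) as [d [Hd B]].
  set (y := Rmin x2 (x + d / 2)).
  assert (Hy : x < y <= x2 /\ y <= x + d / 2).
  { unfold y; split; [split; [apply Rmin_glb_lt; lra|apply Rmin_l]|apply Rmin_r]. }
  rewrite <- (Good y x2); [apply B; apply Rabs_lt_between; lra|lra|lra|right].
  rewrite <- E; apply exp_increasing; lra. }
intros x1 x2 H12 H2.
destruct (Rlt_dec (exp x2) r0); [apply Good; auto|].
destruct (Rlt_dec r0 (exp x1)); [apply Good; auto|].
assert (Hr : 0 < r0) by (pose proof (exp_pos x1); lra).
assert (E : exp (ln r0) = r0) by (apply exp_ln; auto).
assert (L1 : x1 <= ln r0) by (apply Rnot_lt_le; intros H; apply exp_increasing in H; lra).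
assert (L2 : ln r0 <= x2) by (apply Rnot_lt_le; intros H; apply exp_increasing in H; lra).
transitivity (circle_int q (ln r0)).
- destruct L1 as [L1|L1]; [apply Left; auto; lra|rewrite L1; auto].
- destruct L2 as [L2|L2]; [apply Right; auto; lra|rewrite L2; auto].
Qed.

(** Let the radius tend to zero. *)
Lemma mean_value q r0 : disk_cont q ->
  (forall z, Cmod z < 1 -> Cmod z <> r0 -> exists l, cderiv q z l) ->
  forall x, x < 0 -> circle_int q x = (RtoC (2 * PI) * q 0)%C.
Proof.
intros Hc Hq x Hx. pose proof PI_RGT_0 as Hpi.
apply Cminus_eq_0. apply Cmod_eq_0, Rle_antisym; [|apply Cmod_ge_0].
apply le_epsilon; intros eps He. rewrite Rplus_0_l.
assert (H0 : Cmod 0 < 1) by (rewrite Cmod_0; lra).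
destruct (ccont_eps (T := C_UniformSpace) q (RtoC 0)) as [C0 _].
specialize (C0 (Hc _ H0) (eps / (2 * PI)) ltac:(apply Rdiv_lt_0_compat; lra)).
apply locally_C_iff in C0; destruct C0 as [d [Hd B]].
set (y := Rmin x (ln d - 1)).
assert (Hy : y <= x /\ y < ln d) by (unfold y; split; [apply Rmin_l|eapply Rle_lt_trans; [apply Rmin_r|lra]]).
rewrite <- (circle_int_const q r0 Hc Hq y x) by lra.
assert (Ey : exp y < d) by (rewrite <- (exp_ln d Hd); apply exp_increasing; lra).
assert (C1 : ccont_on (fun t => q (circ y t)) 0 (2 * PI)).
{ apply circle_cont_on; intros z Hz; apply Hc; rewrite Hz; apply exp_lt_1; lra. }
unfold circle_int. 
replace (RtoC (2 * PI) * q 0%C)%C with (CInt (fun _ => q 0%C) 0 (2 * PI)) by (rewrite CInt_const; do 2 f_equal; ring).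
rewrite <- CInt_minus; [|apply PI2_pos|auto|intros t _; apply continuous_const].
replace eps with (eps / (2 * PI) * (2 * PI - 0)) by (field; lra).
apply CInt_bound_const; [apply PI2_pos| |].
{ intros t Ht; apply ccont_minus; [apply C1; auto|apply continuous_const]. }
intros t Ht. left. apply B. replace (circ y t - 0)%C with (circ y t) by ring. rewrite Cmod_circ; auto.
Qed.

Lemma Cmod_minus_le z w : Cmod z - Cmod w <= Cmod (z - w)%C.
Proof.
pose proof (Cmod_triangle (z - w) w) as H. replace (z - w + w)%C with z in H by ring. lra.
Qed.

Lemma neq_of_Cmod z w : Cmod w < Cmod z -> (z - w)%C <> 0%C.
Proof. intros H E. pose proof (Cmod_minus_le z w) as K. rewrite E, Cmod_0 in K; lra. Qed.

Lemma Cminus_neq0 (z w : C) : z <> w -> (z - w)%C <> 0%C.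
Proof. intros H E; apply H, Cminus_eq_0, E. Qed.

Lemma kernel_deriv z w : w <> z -> cderiv (fun w => w / (w - z))%C w ((1 * (w - z) - w * (1 - 0)) / ((w - z) * (w - z)))%C.
Proof.
intros H. apply (cderiv_div (fun w => w) (fun w => w - z)%C).
- apply Cminus_neq0, H.
- apply cderiv_id.
- apply cderiv_minus; [apply cderiv_id|apply cderiv_const].
Qed.

(** Let the radius tend to infinity, where the integrand tends to [1]. *)
Lemma circle_int_kernel z x : Cmod z < exp x ->
  circle_int (fun w => w / (w - z))%C x = RtoC (2 * PI).
Proof.
intros Hz. pose proof PI_RGT_0 as Hpi. pose proof (Cmod_ge_0 z) as Hz0.
apply Cminus_eq_0. apply Cmod_eq_0, Rle_antisym; [|apply Cmod_ge_0].
apply le_epsilon; intros eps He. rewrite Rplus_0_l.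
(* a radius at which [|z| / (Rr - |z|)] is below [eps / (2 PI)] *)
set (Rr := Rmax (exp x) (Cmod z + 2 * PI * Cmod z / eps)).
assert (HR : 0 < Rr) by (apply Rlt_le_trans with (1 := exp_pos x), Rmax_l).
assert (HR1 : exp x <= Rr) by apply Rmax_l.
assert (HR2 : Cmod z + 2 * PI * Cmod z / eps <= Rr) by apply Rmax_r.
assert (Ne : forall w, exp x <= Cmod w -> w <> z) by (intros w Hw ->; lra).
rewrite (circle_int_deform _ x (ln Rr)).
2: { apply Rnot_lt_le; intros H; apply exp_increasing in H; rewrite exp_ln in H; lra. }
2: { intros w [Hw _]. eexists; apply kernel_deriv, Ne, Hw. }
assert (C1 : ccont_on (fun t => circ (ln Rr) t / (circ (ln Rr) t - z))%C 0 (2 * PI)).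
{ apply (circle_cont_on (fun w => w / (w - z))%C).
  intros w Hw. eapply cderiv_cont, kernel_deriv, Ne. rewrite Hw, exp_ln; lra. }
unfold circle_int.
replace (RtoC (2 * PI)) with (CInt (fun _ => RtoC 1) 0 (2 * PI)) by (rewrite CInt_const; apply C_ext; simpl; ring).
rewrite <- CInt_minus; [|apply PI2_pos|auto|intros t _; apply continuous_const].
replace eps with (eps / (2 * PI) * (2 * PI - 0)) by (field; lra).
apply CInt_bound_const; [apply PI2_pos| |].
{ intros t Ht; apply ccont_minus; [apply C1; auto|apply continuous_const]. }
intros t Ht. set (w := circ (ln Rr) t).
assert (Hw : Cmod w = Rr) by (unfold w; rewrite Cmod_circ, exp_ln; auto).
assert (Hn : (w - z)%C <> 0%C) by (apply neq_of_Cmod; lra).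
replace (w / (w - z) - 1)%C with (z / (w - z))%C by (field; auto).
rewrite Cmod_div by auto.
pose proof (Cmod_minus_le w z) as K.
apply Cmod_gt_0 in Hn.
apply Rmult_le_reg_r with (1 := Hn). unfold Rdiv at 1. rewrite Rmult_assoc, Rinv_l, Rmult_1_r by lra.
apply Rle_trans with (eps / (2 * PI) * (2 * PI * Cmod z / eps)); [right; field; lra|].
apply Rmult_le_compat_l; [left; apply Rdiv_lt_0_compat; lra|]. lra.
Qed.

Definition holomorphic (h : C -> C) : Prop := forall z, Cmod z < 1 -> exists l, cderiv h z l.

Lemma holo_cont h : holomorphic h -> disk_cont h.
Proof. intros H z Hz; destruct (H z Hz) as [l Hl]; exact (cderiv_cont _ _ _ Hl). Qed.

Definition slope (h : C -> C) (z l w : C) : C :=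
  if Ceq_dec w z then l else ((h w - h z) / (w - z))%C.

Lemma slope_cont h z l : holomorphic h -> Cmod z < 1 -> cderiv h z l -> disk_cont (slope h z l).
Proof.
intros Hh Hz Hl w Hw.
destruct (Ceq_dec w z) as [->|E].
- apply ccont_eps; intros eps He.
  generalize (cderiv_elim _ _ _ Hl (eps / 2) ltac:(lra)). apply filter_imp. intros v Hv.
  unfold slope. destruct (Ceq_dec z z) as [_|]; [|congruence].
  destruct (Ceq_dec v z) as [->|E].
  + replace (l - l)%C with (RtoC 0) by ring; rewrite Cmod_0; auto.
  + change (v <> z) in E. pose proof (Cminus_neq0 v z E) as Hn.
    replace ((h v - h z) / (v - z) - l)%C with ((h v - h z - l * (v - z)) / (v - z))%C by (cfield; auto).
    rewrite Cmod_div by auto. apply Cmod_gt_0 in Hn.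
    apply Rle_lt_trans with (eps / 2); [|lra].
    apply Rmult_le_reg_r with (1 := Hn). unfold Rdiv at 1. rewrite Rmult_assoc, Rinv_l by lra. lra.
- apply (continuous_ext_loc _ (fun v => (h v - h z) / (v - z))%C).
  + pose proof (Cminus_neq0 w z E) as Hn.
    generalize (ccont_neq0 (T := C_UniformSpace) (fun v => v - z)%C w Hn
      (ccont_minus (T := C_UniformSpace) (fun v => v) (fun _ => z) w (continuous_id _) (continuous_const _ _))).
    apply filter_imp. intros v Hv. unfold slope. destruct (Ceq_dec v z) as [->|]; auto.
    exfalso; apply Hv; cring.
  + apply ccont_div; [apply Cminus_neq0, E| |].
    * apply ccont_minus; [apply holo_cont; auto|apply continuous_const].
    * apply ccont_minus; [apply continuous_id|apply continuous_const].
Qed.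

Lemma slope_deriv h z l w : holomorphic h -> Cmod w < 1 -> w <> z -> exists m, cderiv (slope h z l) w m.
Proof.
intros Hh Hw E. destruct (Hh w Hw) as [m Hm]. eexists.
apply (cderiv_ext_loc (fun v => (h v - h z) / (v - z))%C).
- pose proof (Cminus_neq0 w z E) as Hn.
  generalize (ccont_neq0 (T := C_UniformSpace) (fun v => v - z)%C w Hn
      (ccont_minus (T := C_UniformSpace) (fun v => v) (fun _ => z) w (continuous_id _) (continuous_const _ _))).
  apply filter_imp. intros v Hv. unfold slope. destruct (Ceq_dec v z) as [->|]; auto.
  exfalso; apply Hv; cring.
- apply cderiv_div; [apply Cminus_neq0, E| |].
  + apply cderiv_minus; [exact Hm|apply cderiv_const].
  + apply cderiv_minus; [apply cderiv_id|apply cderiv_const].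
Qed.

(** The function [w (h w - h z) / (w - z)], extended to [w = z], has mean value
    [0]; the contribution of [h z] is computed by [circle_int_kernel]. *)
Lemma cauchy_formula h z x : holomorphic h -> Cmod z < exp x -> x < 0 ->
  circle_int (fun w => w * h w / (w - z))%C x = (RtoC (2 * PI) * h z)%C.
Proof.
intros Hh Hz Hx. pose proof (exp_lt_1 x Hx) as Hx1.
destruct (Hh z ltac:(lra)) as [l Hl].
assert (M : circle_int (fun w => w * slope h z l w)%C x = (RtoC (2 * PI) * (0 * slope h z l 0))%C).
{ apply (mean_value (fun w => w * slope h z l w)%C (Cmod z)); auto.
  - intros w Hw. apply ccont_mult; [apply continuous_id|apply slope_cont; auto; lra].
  - intros w Hw Hn. destruct (slope_deriv h z l w Hh Hw) as [m Hm]; [congruence|].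
    eexists; apply cderiv_mult; [apply cderiv_id|exact Hm]. }
assert (Ne : forall w, Cmod w = exp x -> w <> z) by (intros w Hw ->; lra).
assert (C1 : ccont_on (fun t => circ x t / (circ x t - z))%C 0 (2 * PI)).
{ apply (circle_cont_on (fun w => w / (w - z))%C). intros w Hw. eapply cderiv_cont, kernel_deriv, Ne, Hw. }
assert (C2 : ccont_on (fun t => circ x t * slope h z l (circ x t))%C 0 (2 * PI)).
{ apply (circle_cont_on (fun w => w * slope h z l w)%C). intros w Hw.
  apply ccont_mult; [apply continuous_id|apply slope_cont; auto; lra]. }
transitivity (CInt (fun t => circ x t * slope h z l (circ x t) + h z * (circ x t / (circ x t - z)))%C 0 (2 * PI)).
- apply CInt_ext; [apply PI2_pos|]. intros t _.
  assert (E : circ x t <> z) by (apply Ne, Cmod_circ).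
  unfold slope. destruct (Ceq_dec (circ x t) z); [contradiction|].
  field. apply Cminus_neq0, E.
- rewrite CInt_plus; [|apply PI2_pos|auto|].
  2: { intros t Ht; apply ccont_mult; [apply continuous_const|apply C1; auto]. }
  rewrite CInt_scal; [|apply PI2_pos|auto].
  change (circle_int (fun w => w * slope h z l w)%C x + h z * circle_int (fun w => w / (w - z))%C x = RtoC (2 * PI) * h z)%C.
  rewrite M, circle_int_kernel by auto. ring.
Qed.

(** * Regularity of derivatives and the Schwarz-Pick inequality *)

Lemma circle_bounded q x : (forall z, Cmod z = exp x ->
    ccontinuous q z) ->
  exists M, 0 <= M /\ forall t, 0 <= t <= 2 * PI -> Cmod (q (circ x t)) <= M.
Proof.
intros H.
destruct (continuity_ab_maj (fun t => Cmod (q (circ x t))) 0 (2 * PI) PI2_pos) as [t0 [Ht _]].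
- intros t Ht. apply continuity_pt_filterlim.
  apply (ccont_Cmod (fun t => q (circ x t))). apply (circle_cont_on q x H 0 (2 * PI) t Ht).
- exists (Cmod (q (circ x t0))); split; [apply Cmod_ge_0|]. exact Ht.
Qed.

(** Differentiation under the integral sign, with a uniform second-order bound
    on the remainder of the kernel. *)
Lemma circle_int_param (K : C -> C -> C) (K1 : C -> C) (z : C) (x r B : R) : 0 < r -> 0 <= B ->
  (forall v w, Cmod (v - z)%C < r -> Cmod w = exp x ->
     ccontinuous (K v) w) ->
  (forall w, Cmod w = exp x -> ccontinuous K1 w) ->
  (forall v t, Cmod (v - z)%C < r -> 0 <= t <= 2 * PI -> let w := circ x t in
     Cmod (K v w - K z w - K1 w * (v - z))%C <= B * Cmod (v - z)%C ^ 2) ->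
  cderiv (fun v => circle_int (K v) x) z (circle_int K1 x).
Proof.
intros Hr HB HK HK1 Hb. pose proof PI_RGT_0 as Hpi.
apply cderiv_intro; intros eps He. apply locally_C_iff.
exists (Rmin r (eps / (2 * PI * B + 1))).
assert (HD : 0 < 2 * PI * B + 1) by nra.
split. { apply Rmin_glb_lt; auto. apply Rdiv_lt_0_compat; auto. }
intros v Hv.
assert (H1 : Cmod (v - z)%C < r) by (apply Rlt_le_trans with (1 := Hv), Rmin_l).
assert (H2 : Cmod (v - z)%C < eps / (2 * PI * B + 1)) by (apply Rlt_le_trans with (1 := Hv), Rmin_r).
assert (H0 : Cmod (z - z)%C < r) by (replace (z - z)%C with (RtoC 0) by ring; rewrite Cmod_0; auto).
set (m := Cmod (v - z)%C) in *. assert (Hm : 0 <= m) by apply Cmod_ge_0.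
pose proof (circle_cont_on _ x (fun w => HK v w H1) 0 (2 * PI)) as Cv.
pose proof (circle_cont_on _ x (fun w => HK z w H0) 0 (2 * PI)) as Cz.
pose proof (circle_cont_on _ x HK1 0 (2 * PI)) as Ck.
assert (Cd : ccont_on (fun t => K v (circ x t) - K z (circ x t))%C 0 (2 * PI))
  by (intros t Ht; apply ccont_minus; [apply Cv|apply Cz]; auto).
assert (Cl : ccont_on (fun t => (v - z) * K1 (circ x t))%C 0 (2 * PI))
  by (intros t Ht; apply ccont_mult; [apply continuous_const|apply Ck]; auto).
replace (circle_int (K v) x - circle_int (K z) x - circle_int K1 x * (v - z))%C
  with (CInt (fun t => K v (circ x t) - K z (circ x t) - (v - z) * K1 (circ x t))%C 0 (2 * PI)).
2: { rewrite CInt_minus by (auto using PI2_pos). rewrite CInt_minus by (auto using PI2_pos).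
     rewrite CInt_scal by (auto using PI2_pos). unfold circle_int; ring. }
apply Rle_trans with ((B * m ^ 2) * (2 * PI - 0)).
- apply CInt_bound_const; [apply PI2_pos| |].
  + intros t Ht; apply ccont_minus; [apply Cd|apply Cl]; auto.
  + intros t Ht. rewrite (Cmult_comm (v - z)). apply Hb; auto.
- apply Rle_trans with (m * (2 * PI * B * m)); [right; ring|].
  rewrite (Rmult_comm eps). apply Rmult_le_compat_l; auto.
  assert (m * (2 * PI * B + 1) <= eps).
  { apply Rle_trans with (eps / (2 * PI * B + 1) * (2 * PI * B + 1)); [apply Rmult_le_compat_r; lra|right; field; lra]. }
  nra.
Qed.

Lemma Cmod_inv_le d s : 0 < s -> / s <= Cmod d -> Cmod (/ d)%C <= s.
Proof.
intros Hs Hd. pose proof (Rinv_0_lt_compat _ Hs).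
rewrite Cmod_inv by (apply Cmod_gt_0; lra).
rewrite <- (Rinv_inv s). apply Rinv_le_contravar; auto.
Qed.

(** With [d = w - z] and [e = v - z], the remainders of [1 / d] and [1 / d^2] at
    [d - e] are [e^2] times products of inverses of [d] and [d - e], which stay
    bounded because [v] is at a positive distance from the circle. *)
Lemma cauchy_kernel_deriv (phi : C -> C) (z : C) (x : R) :
  (forall w, Cmod w = exp x -> ccontinuous phi w) ->
  Cmod z < exp x ->
  cderiv (fun z => circle_int (fun w => phi w / (w - z))%C x) z
         (circle_int (fun w => phi w / ((w - z) * (w - z)))%C x) /\
  cderiv (fun z => circle_int (fun w => phi w / ((w - z) * (w - z)))%C x) z
         (circle_int (fun w => 2 * phi w / ((w - z) * (w - z) * (w - z)))%C x).
Proof.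
intros Hphi Hz. destruct (circle_bounded phi x Hphi) as [M [HM0 HM]].
set (r := (exp x - Cmod z) / 2). assert (Hr : 0 < r) by (unfold r; lra).
set (s := / r). assert (Hs : 0 < s) by (apply Rinv_0_lt_compat; auto).
assert (Far : forall v w, Cmod (v - z)%C < r -> Cmod w = exp x -> r <= Cmod (w - v)%C).
{ intros v w Hv Hw. pose proof (Cmod_minus_le w v). pose proof (Cmod_minus_le v z). unfold r in *; lra. }
assert (Ne : forall v w, Cmod (v - z)%C < r -> Cmod w = exp x -> (w - v)%C <> 0%C).
{ intros v w Hv Hw. apply Cmod_gt_0. specialize (Far v w Hv Hw); lra. }
assert (H0 : Cmod (z - z)%C < r) by (replace (z - z)%C with (RtoC 0) by ring; rewrite Cmod_0; auto).
assert (Cl : forall v w, ccontinuous (fun w => w - v)%C w)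
  by (intros; apply ccont_minus; [apply continuous_id|apply continuous_const]).
assert (Inv : forall v w, Cmod (v - z)%C < r -> Cmod w = exp x -> Cmod (/ (w - v))%C <= s).
{ intros v w Hv Hw. apply Cmod_inv_le; auto. unfold s; rewrite Rinv_inv; auto. }
assert (Bd : forall v t (X : C) b, 0 <= b -> 0 <= t <= 2 * PI -> Cmod X <= b ->
   Cmod (phi (circ x t) * (X * ((v - z) * (v - z))))%C <= M * b * Cmod (v - z)%C ^ 2).
{ intros v t X b Hb Ht HX. rewrite !Cmod_mult. pose proof (Cmod_ge_0 (v - z)).
  rewrite Rmult_assoc. apply Rmult_le_compat; auto using Cmod_ge_0.
  - apply Rmult_le_pos; [apply Cmod_ge_0|apply Rmult_le_pos; auto].
  - simpl. rewrite Rmult_1_r. apply Rmult_le_compat_r; [apply Rmult_le_pos; auto|auto]. }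
split.
- apply (circle_int_param (fun z w => phi w / (w - z))%C (fun w => phi w / ((w - z) * (w - z)))%C z x r (M * (s * s * s))); auto.
  + repeat apply Rmult_le_pos; lra.
  + intros v w Hv Hw. apply ccont_div; auto.
  + intros w Hw. apply ccont_div; auto; [apply Cmult_neq_0; auto|apply ccont_mult; auto].
  + intros v t Hv Ht w.
    assert (Hw : Cmod w = exp x) by apply Cmod_circ.
    pose proof (Ne v w Hv Hw) as N1. pose proof (Ne z w H0 Hw) as N2.
    replace (phi w / (w - v) - phi w / (w - z) - phi w / ((w - z) * (w - z)) * (v - z))%C
      with (phi w * ((/ (w - z) * / (w - z) * / (w - v)) * ((v - z) * (v - z))))%C by (field; auto).
    apply Bd; auto; [repeat apply Rmult_le_pos; lra|].
    rewrite !Cmod_mult. pose proof (Inv v w Hv Hw). pose proof (Inv z w H0 Hw).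
    repeat apply Rmult_le_compat; try apply Rmult_le_pos; auto using Cmod_ge_0.
- apply (circle_int_param (fun z w => phi w / ((w - z) * (w - z)))%C (fun w => 2 * phi w / ((w - z) * (w - z) * (w - z)))%C z x r (M * (3 * (s * s * s * s)))); auto.
  + repeat apply Rmult_le_pos; lra.
  + intros v w Hv Hw. apply ccont_div; auto; [apply Cmult_neq_0; auto|apply ccont_mult; auto].
  + intros w Hw. apply ccont_div.
    * repeat apply Cmult_neq_0; auto.
    * apply ccont_mult; auto; apply continuous_const.
    * apply ccont_mult; [apply ccont_mult|]; auto.
  + intros v t Hv Ht w.
    assert (Hw : Cmod w = exp x) by apply Cmod_circ.
    pose proof (Ne v w Hv Hw) as N1. pose proof (Ne z w H0 Hw) as N2.
    replace (phi w / ((w - v) * (w - v)) - phi w / ((w - z) * (w - z)) - 2 * phi w / ((w - z) * (w - z) * (w - z)) * (v - z))%C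
      with (phi w * ((/ (w - z) * / (w - z) * / (w - v) * / (w - v) + 2 * (/ (w - z) * / (w - z) * / (w - z) * / (w - v)))
              * ((v - z) * (v - z))))%C by (field; auto).
    apply Bd; auto; [repeat apply Rmult_le_pos; lra|].
    eapply Rle_trans; [apply Cmod_triangle|].
    rewrite !Cmod_mult. pose proof (Inv v w Hv Hw). pose proof (Inv z w H0 Hw).
    rewrite Cmod_R, Rabs_right by lra.
    replace (3 * (s * s * s * s)) with (s * s * s * s + 2 * (s * s * s * s)) by ring.
    apply Rplus_le_compat; [|apply Rmult_le_compat_l; [lra|]];
    repeat apply Rmult_le_compat; repeat apply Rmult_le_pos; auto using Cmod_ge_0.
Qed.

Lemma exists_radius z : Cmod z < 1 -> exists x, x < 0 /\ Cmod z < exp x.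
Proof.
intros Hz. pose proof (Cmod_ge_0 z). set (m := (Cmod z + 1) / 2).
assert (Hm : 0 < m < 1) by (unfold m; lra).
exists (ln m). rewrite exp_ln by lra. split; [rewrite <- ln_1; apply ln_increasing; lra|unfold m; lra].
Qed.

Lemma holo_C_derive h : holomorphic h -> holomorphic (C_derive h).
Proof.
intros Hh z Hz. pose proof PI_RGT_0 as Hpi.
destruct (exists_radius z Hz) as [x [Hx Hzx]]. pose proof (exp_lt_1 x Hx) as Hx1.
assert (P2 : RtoC (2 * PI) <> 0%C) by (intros E; apply RtoC_inj in E; lra).
assert (Cphi : forall w, Cmod w = exp x -> ccontinuous (fun w => w * h w)%C w).
{ intros w Hw. apply ccont_mult; [apply continuous_id|apply holo_cont; auto; lra]. }
assert (Near : forall v, Cmod v < exp x -> clocally v (fun w => Cmod w < exp x)).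
{ intros v Hv. apply locally_C_iff. exists (exp x - Cmod v); split; [lra|].
  intros w Hw. pose proof (Cmod_minus_le w v); lra. }
assert (D1 : forall v, Cmod v < exp x -> C_derive h v =
   (/ RtoC (2 * PI) * circle_int (fun w => w * h w / ((w - v) * (w - v)))%C x)%C).
{ intros v Hv. apply cderiv_C_derive.
  apply (cderiv_ext_loc (fun v => / RtoC (2 * PI) * circle_int (fun w => w * h w / (w - v))%C x)%C).
  - generalize (Near v Hv); apply filter_imp. intros w Hw. rewrite cauchy_formula by auto. field; auto.
  - replace (/ RtoC (2 * PI) * circle_int (fun w => w * h w / ((w - v) * (w - v)))%C x)%C
      with (0 * circle_int (fun w => w * h w / (w - v))%C x + / RtoC (2 * PI) * circle_int (fun w => w * h w / ((w - v) * (w - v)))%C x)%C by ring.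
    apply (cderiv_mult (fun _ => / RtoC (2 * PI))%C); [apply cderiv_const|].
    apply (cauchy_kernel_deriv (fun w => w * h w)%C v x Cphi Hv). }
eexists. apply (cderiv_ext_loc (fun v => / RtoC (2 * PI) * circle_int (fun w => w * h w / ((w - v) * (w - v)))%C x)%C).
- generalize (Near z Hzx); apply filter_imp. intros w Hw. rewrite D1; auto.
- apply (cderiv_mult (fun _ => / RtoC (2 * PI))%C); [apply cderiv_const|].
  apply (cauchy_kernel_deriv (fun w => w * h w)%C z x Cphi Hzx).
Qed.

Lemma holo_deriv h z : holomorphic h -> Cmod z < 1 -> cderiv h z (C_derive h z).
Proof. intros Hh Hz; destruct (Hh z Hz) as [l Hl]. rewrite (cderiv_C_derive h z l); auto. Qed.

Lemma holo_bounded h r : holomorphic h -> r < 1 -> exists B, 0 <= B /\ forall z, Cmod z <= r -> Cmod (h z) <= B.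
Proof.
intros Hh Hr. pose proof PI_RGT_0 as Hpi.
assert (Hr0 : Cmod (RtoC (Rmax r 0)) < 1).
{ rewrite Cmod_R, Rabs_right; [apply Rmax_lub_lt; lra|apply Rle_ge, Rmax_r]. }
destruct (exists_radius _ Hr0) as [x [Hx Hrx]]. pose proof (exp_lt_1 x Hx) as Hx1.
rewrite Cmod_R, Rabs_right in Hrx by (apply Rle_ge, Rmax_r).
destruct (circle_bounded h x) as [M [HM0 HM]]. { intros z Hz; apply holo_cont; auto; lra. }
pose proof (Rmax_l r 0) as Hm. pose proof (exp_pos x) as He.
exists (exp x * M * / (exp x - Rmax r 0)).
assert (Hi : 0 < / (exp x - Rmax r 0)) by (apply Rinv_0_lt_compat; lra).
split. { repeat apply Rmult_le_pos; lra. }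
intros z Hz.
assert (E : Cmod (RtoC (2 * PI) * h z)%C <= exp x * M * / (exp x - Rmax r 0) * (2 * PI - 0)).
{ rewrite <- (cauchy_formula h z x) by (auto; lra).
  apply CInt_bound_const; [apply PI2_pos| |].
  - apply (circle_cont_on (fun w => w * h w / (w - z))%C). intros w Hw. apply ccont_div.
    + apply neq_of_Cmod; lra.
    + apply ccont_mult; [apply continuous_id|apply holo_cont; auto; lra].
    + apply ccont_minus; [apply continuous_id|apply continuous_const].
  - intros t Ht. unfold Cdiv. rewrite !Cmod_mult, Cmod_circ.
    apply Rmult_le_compat; auto using Cmod_ge_0.
    + apply Rmult_le_pos; [lra|apply Cmod_ge_0].
    + apply Rmult_le_compat_l; [lra|auto].
    + apply Cmod_inv_le; auto. rewrite Rinv_inv.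
      eapply Rle_trans; [|apply Cmod_minus_le]. rewrite Cmod_circ; lra. }
rewrite Cmod_mult, Cmod_R, Rabs_right, Rminus_0_r, (Rmult_comm (2 * PI)) in E by lra.
apply Rmult_le_reg_r in E; lra.
Qed.

Lemma one_minus_sqr_pos (z : C) : Cmod z < 1 -> 0 < 1 - Cmod z ^ 2.
Proof. intros H; pose proof (Cmod_ge_0 z); nra. Qed.

Lemma moebius_identity (a c : C) :
  Cmod (1 - Cconj c * a)%C ^ 2 - Cmod (a - c)%C ^ 2 = (1 - Cmod a ^ 2) * (1 - Cmod c ^ 2).
Proof. rewrite !Cmod2_alt. destruct a, c; simpl; ring. Qed.

Lemma moebius_neq0 (a c : C) : Cmod a < 1 -> Cmod c < 1 -> (1 - Cconj c * a)%C <> 0%C.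
Proof.
intros Ha Hc. apply neq_of_Cmod. rewrite Cmod_mult, Cmod_conj, Cmod_1.
pose proof (Cmod_ge_0 a). pose proof (Cmod_ge_0 c). nra.
Qed.

Lemma moebius_disk (a c : C) : Cmod a < 1 -> Cmod c < 1 -> Cmod ((a - c) / (1 - Cconj c * a))%C < 1.
Proof.
intros Ha Hc. pose proof (moebius_neq0 a c Ha Hc) as N.
rewrite Cmod_div by auto. apply Cmod_gt_0 in N.
pose proof (moebius_identity a c) as E.
pose proof (Cmod_ge_0 a). pose proof (Cmod_ge_0 c). pose proof (Cmod_ge_0 (a - c)).
apply Rmult_lt_reg_r with (1 := N). unfold Rdiv. rewrite Rmult_assoc, Rinv_l by lra.
assert (0 < (1 - Cmod a ^ 2) * (1 - Cmod c ^ 2)) by (apply Rmult_lt_0_compat; apply one_minus_sqr_pos; auto).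
nra.
Qed.

(** The quotient [F w / w] has mean value [l] and modulus at most [e^(-x)] on the
    circle of radius [e^x]; let [x] tend to [0]. *)
Lemma schwarz_lemma F l : holomorphic F -> (forall z, Cmod z < 1 -> Cmod (F z) < 1) -> F 0%C = 0%C ->
  cderiv F 0%C l -> Cmod l <= 1.
Proof.
intros HF HB H0 Hl. pose proof PI_RGT_0 as Hpi.
assert (H00 : Cmod 0 < 1) by (rewrite Cmod_0; lra).
assert (K : forall x, x < 0 -> Cmod l * exp x <= 1).
{ intros x Hx. pose proof (exp_lt_1 x Hx) as Hx1. pose proof (exp_pos x) as Hp.
  assert (E : circle_int (slope F 0 l) x = (RtoC (2 * PI) * slope F 0 l 0)%C).
  { apply (mean_value _ 0); auto.
    - apply slope_cont; auto.
    - intros z Hz Hz0. apply slope_deriv; auto. intros ->. apply Hz0, Cmod_0. }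
  replace (slope F 0 l 0) with l in E by (unfold slope; destruct (Ceq_dec 0 0); congruence).
  assert (B : Cmod (circle_int (slope F 0 l) x) <= / exp x * (2 * PI - 0)).
  { apply CInt_bound_const; [apply PI2_pos| |].
    - apply circle_cont_on. intros z Hz. apply slope_cont; auto; lra.
    - intros t Ht. unfold slope.
      assert (N : circ x t <> 0%C) by (apply Cmod_gt_0; rewrite Cmod_circ; auto).
      destruct (Ceq_dec (circ x t) 0) as [|_]; [contradiction|]. rewrite H0.
      replace ((F (circ x t) - 0) / (circ x t - 0))%C with (F (circ x t) / circ x t)%C by (field; auto).
      rewrite Cmod_div, Cmod_circ by auto. specialize (HB (circ x t)). rewrite Cmod_circ in HB.
      unfold Rdiv. rewrite <- (Rmult_1_l (/ exp x)) at 2. apply Rmult_le_compat_r; [left; apply Rinv_0_lt_compat; auto|].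
      left; auto. }
  rewrite E, Cmod_mult, Cmod_R, Rabs_right, Rminus_0_r, (Rmult_comm (2 * PI)) in B by lra.
  apply Rmult_le_reg_r in B; [|lra].
  apply Rle_trans with (/ exp x * exp x); [apply Rmult_le_compat_r; lra|right; field; lra]. }
destruct (Rle_lt_dec (Cmod l) 1) as [|H]; auto. exfalso.
set (L := Cmod l) in *.
(* at radius [L^(-1/2)] the bound reads [L^(1/2) <= 1] *)
specialize (K (- ln L / 2)). 
assert (Hln : 0 < ln L) by (rewrite <- ln_1; apply ln_increasing; lra).
specialize (K ltac:(lra)).
replace (L * exp (- ln L / 2)) with (exp (ln L + - ln L / 2)) in K by (rewrite exp_plus, exp_ln; lra).
assert (exp 0 < exp (ln L + - ln L / 2)) by (apply exp_increasing; lra).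
rewrite exp_0 in *. lra.
Qed.

(** Schwarz's lemma for [om] composed on both sides with disk automorphisms that
    move [z] and [om z] to the origin. *)
Lemma schwarz_pick om z l : holomorphic om -> (forall z, Cmod z < 1 -> Cmod (om z) < 1) -> Cmod z < 1 ->
  cderiv om z l -> Cmod l * (1 - Cmod z ^ 2) <= 1 - Cmod (om z) ^ 2.
Proof.
intros Ho HB Hz Hl.
set (c := om z). assert (Hc : Cmod c < 1) by (apply HB; auto).
set (psi := fun w => ((w - - z) / (1 - Cconj (- z) * w))%C).
set (F := fun w => ((om (psi w) - c) / (1 - Cconj c * om (psi w)))%C).
assert (Hz' : Cmod (- z)%C < 1) by (rewrite Cmod_opp; auto).
assert (Hpsi : forall w, Cmod w < 1 -> Cmod (psi w) < 1) by (intros; apply moebius_disk; auto).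
assert (D1 : forall w (d : C), Cmod w < 1 -> Cmod d < 1 -> cderiv (fun w => (w - d) / (1 - Cconj d * w))%C w
   (((1 - 0) * (1 - Cconj d * w) - (w - d) * (0 - (0 * w + Cconj d * 1))) / ((1 - Cconj d * w) * (1 - Cconj d * w)))%C).
{ intros w d Hw Hd. apply (cderiv_div (fun w => w - d)%C (fun w => 1 - Cconj d * w)%C).
  - apply moebius_neq0; auto.
  - apply cderiv_minus; [apply cderiv_id|apply cderiv_const].
  - apply cderiv_minus; [apply cderiv_const|]. apply (cderiv_mult (fun _ => Cconj d) (fun w => w)); [apply cderiv_const|apply cderiv_id]. }
assert (H00 : Cmod 0 < 1) by (rewrite Cmod_0; lra).
assert (P0 : psi 0%C = z) by (unfold psi; field; replace (1 - Cconj (- z) * 0)%C with (RtoC 1) by ring; apply C1_nz).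
assert (DF : forall w m, Cmod w < 1 -> cderiv om (psi w) m -> cderiv F w
  ((((1 - 0) * (1 - Cconj c * om (psi w)) - (om (psi w) - c) * (0 - (0 * om (psi w) + Cconj c * 1))) / ((1 - Cconj c * om (psi w)) * (1 - Cconj c * om (psi w)))) *
   (m * (((1 - 0) * (1 - Cconj (- z) * w) - (w - - z) * (0 - (0 * w + Cconj (- z) * 1))) / ((1 - Cconj (- z) * w) * (1 - Cconj (- z) * w)))))%C).
{ intros w m Hw Hm.
  apply (cderiv_comp (fun v => (v - c) / (1 - Cconj c * v))%C (fun w => om (psi w))).
  - apply D1; auto.
  - apply (cderiv_comp om psi); auto. apply D1; auto. }
assert (HF : holomorphic F).
{ intros w Hw. destruct (Ho (psi w)) as [m Hm]; [auto|]. eexists; apply DF; eauto. }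
assert (D0 := DF 0%C l H00). rewrite P0 in D0. specialize (D0 Hl). fold c in D0.
apply schwarz_lemma in D0; auto.
2: { intros w Hw; apply moebius_disk; auto. }
2: { unfold F. rewrite P0. fold c. field. apply moebius_neq0; auto. }
pose proof (moebius_neq0 c c Hc Hc) as Nc.
assert (Cc : forall a : C, (Cconj a * a)%C = RtoC (Cmod a ^ 2)) by (intros a; rewrite Cmod2_conj; ring).
assert (G : forall X : C, X = (l * (1 - Cconj z * z) / (1 - Cconj c * c))%C -> Cmod X <= 1 ->
   Cmod l * (1 - Cmod z ^ 2) <= 1 - Cmod c ^ 2).
{ intros X -> HX. rewrite Cmod_div, Cmod_mult in HX by auto.
  rewrite !Cc, <- !RtoC_minus, !Cmod_R, !Rabs_right in HX.
  2,3: apply Rle_ge, Rlt_le, one_minus_sqr_pos; auto.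
  pose proof (one_minus_sqr_pos c Hc).
  apply Rmult_le_reg_r with (/ (1 - Cmod c ^ 2)); [apply Rinv_0_lt_compat; auto|].
  rewrite Rinv_r by lra. exact HX. }
refine (G _ _ D0).
replace (Cconj (- z)) with (- Cconj z)%C by (apply C_ext; simpl; ring).
field; auto.
Qed.

(** * From the pre-Schwarzian of [f] to that of its analytic part *)

Lemma analytic_holo h : analytic_on_disk h -> holomorphic h.
Proof. intros H z Hz. destruct (H z Hz) as [l Hl]. exists l. apply cderiv_iff, Hl. Qed.

Lemma sense_preserving_neq0 h g z : sense_preserving h g -> Cmod z < 1 -> C_derive h z <> 0%C.
Proof.
intros H Hz E. specialize (H z Hz). unfold jacobian in H. rewrite E, Cmod_0 in H.
pose proof (pow2_ge_0 (Cmod (C_derive g z))). lra.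
Qed.

Lemma sense_preserving_lt h g z : sense_preserving h g -> Cmod z < 1 ->
  Cmod (C_derive g z) < Cmod (C_derive h z).
Proof.
intros H Hz. specialize (H z Hz). unfold jacobian in H.
pose proof (Cmod_ge_0 (C_derive g z)). pose proof (Cmod_ge_0 (C_derive h z)). nra.
Qed.

(** [h'' / h' = P_f + conj(om) om' / (1 - |om|^2)] with [H], [G], [H2], [G2] in the
    place of [h'], [g'], [h''], [g'']. *)
Lemma dilatation_identity (H G H2 G2 : C) : H <> 0%C -> 0 < Cmod H ^ 2 - Cmod G ^ 2 ->
  (H2 / H = (H2 * Cconj H - G2 * Cconj G) / RtoC (Cmod H ^ 2 - Cmod G ^ 2)
     + Cconj (G / H) * ((G2 * H - G * H2) / (H * H)) / RtoC (1 - Cmod (G / H) ^ 2))%C.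
Proof.
intros H0 HJ.
assert (Hc : Cconj H <> 0%C) by (apply Cmod_gt_0; rewrite Cmod_conj; apply Cmod_gt_0; auto).
assert (EJ : RtoC (Cmod H ^ 2 - Cmod G ^ 2) = (H * Cconj H - G * Cconj G)%C)
  by (rewrite RtoC_minus, !Cmod2_conj; ring).
assert (HJc : (H * Cconj H - G * Cconj G)%C <> 0%C) by (rewrite <- EJ; intros E; apply RtoC_inj in E; lra).
assert (Ec : Cconj (G / H)%C = (Cconj G / Cconj H)%C).
{ replace (Cconj G) with (Cconj (G / H * H)%C) by (f_equal; field; auto). rewrite Cmult_conj. field; auto. }
assert (Ew : RtoC (1 - Cmod (G / H) ^ 2) = ((H * Cconj H - G * Cconj G) / (H * Cconj H))%C)
  by (rewrite RtoC_minus, Cmod2_conj, Ec; field; auto).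
rewrite EJ, Ew, Ec. field. auto.
Qed.

(** Schwarz-Pick bounds [(1 - |z|^2) |om'| / (1 - |om|^2)] by [1], so passing from
    [P_f] to [h'' / h'] costs at most [|om| < 1]. *)
Lemma analytic_pre_schwarzian_bound lambda f h g z :
  class_H f h g -> Rbar_le (pre_schwarzian_norm h g) (Finite lambda) -> Cmod z < 1 ->
  (1 - Cmod z ^ 2) * Cmod (C_derive (C_derive h) z / C_derive h z)%C <= lambda + 1.
Proof.
intros [[Hh [Hg _]] [Hsp _]] Hn Hz.
apply analytic_holo in Hh, Hg.
pose proof (holo_C_derive h Hh) as Hh1. pose proof (holo_C_derive g Hg) as Hg1.
assert (HP : (1 - Cmod z ^ 2) * Cmod (pre_schwarzian h g z) <= lambda).
{ destruct (Lub_Rbar_correct (fun y : R => exists z : C,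
    in_disk z /\ y = (1 - Cmod z ^ 2) * Cmod (pre_schwarzian h g z))) as [U _].
  apply (Rbar_le_trans (Finite _) _ (Finite lambda)) with (2 := Hn). apply U. exists z; split; auto. }
set (om := fun w => (C_derive g w / C_derive h w)%C).
assert (Dom : forall w, Cmod w < 1 -> cderiv om w ((C_derive (C_derive g) w * C_derive h w - C_derive g w * C_derive (C_derive h) w)
   / (C_derive h w * C_derive h w))%C).
{ intros w Hw. apply cderiv_div; [apply (sense_preserving_neq0 h g); auto|apply holo_deriv; auto|apply holo_deriv; auto]. }
assert (Bom : forall w, Cmod w < 1 -> Cmod (om w) < 1).
{ intros w Hw. pose proof (sense_preserving_neq0 h g w Hsp Hw) as N. unfold om. rewrite Cmod_div by auto.
  apply Cmod_gt_0 in N. apply Rmult_lt_reg_r with (1 := N). unfold Rdiv. rewrite Rmult_assoc, Rinv_l by lra.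
  pose proof (sense_preserving_lt h g w Hsp Hw). lra. }
assert (SP := schwarz_pick om z _ (fun w Hw => ex_intro _ _ (Dom w Hw)) Bom Hz (Dom z Hz)).
pose proof (sense_preserving_neq0 h g z Hsp Hz) as N.
rewrite (dilatation_identity _ (C_derive g z) _ (C_derive (C_derive g) z) N (Hsp z Hz)).
fold (jacobian h g z).
fold (pre_schwarzian h g z). fold (om z).
set (d := ((C_derive (C_derive g) z * C_derive h z - C_derive g z * C_derive (C_derive h) z)
   / (C_derive h z * C_derive h z))%C) in *.
pose proof (one_minus_sqr_pos (om z) (Bom z Hz)) as Q.
pose proof (one_minus_sqr_pos z Hz) as Qz.
assert (B2 : (1 - Cmod z ^ 2) * Cmod (Cconj (om z) * d / RtoC (1 - Cmod (om z) ^ 2))%C <= 1).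
{ assert (NQ : RtoC (1 - Cmod (om z) ^ 2) <> 0%C) by (intros E; apply RtoC_inj in E; lra).
  rewrite Cmod_div, Cmod_mult, Cmod_conj, Cmod_R, Rabs_right by (auto; lra).
  apply Rmult_le_reg_r with (1 := Q).
  replace ((1 - Cmod z ^ 2) * (Cmod (om z) * Cmod d / (1 - Cmod (om z) ^ 2)) * (1 - Cmod (om z) ^ 2))
    with (Cmod (om z) * (Cmod d * (1 - Cmod z ^ 2))) by (field; lra).
  apply Rmult_le_compat; auto using Cmod_ge_0.
  - apply Rmult_le_pos; [apply Cmod_ge_0|lra].
  - left; auto. }
eapply Rle_trans; [apply Rmult_le_compat_l; [lra|apply Cmod_triangle]|]. lra.
Qed.

(** This is [t <= sinh t] for [t = - x], multiplied by [2 e^x]. *)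
Lemma sinh_bound x : x <= 0 -> - 2 * x * exp x <= 1 - exp x ^ 2.
Proof.
intros Hx.
assert (G : 0 <= exp (- x) - exp x + 2 * x).
{ destruct Hx as [Hx| ->]; [|rewrite Ropp_0; lra].
  destruct (MVT_cor2 (fun x => exp (- x) - exp x + 2 * x) (fun x => - exp (- x) - exp x + 2) x 0 Hx) as [c [E _]].
  - intros c _. apply is_derive_Reals. auto_derive; auto; ring.
  - rewrite Ropp_0, exp_0 in E.
    assert (0 <= exp (- c) + exp c - 2).
    { assert (E1 : exp (- c) * exp c = 1) by (rewrite <- exp_plus, Rplus_opp_l, exp_0; auto).
      replace (exp (- c) + exp c - 2) with (exp (- c) * (exp c - 1) ^ 2).
      - apply Rmult_le_pos; [left; apply exp_pos|apply pow2_ge_0].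
      - replace (exp (- c) * (exp c - 1) ^ 2) with (exp (- c) * exp c * exp c - 2 * (exp (- c) * exp c) + exp (- c)) by ring.
        rewrite E1; ring. }
    assert (0 <= (exp (- c) + exp c - 2) * (0 - x)) by (apply Rmult_le_pos; lra).
    lra. }
assert (E1 : exp (- x) * exp x = 1) by (rewrite <- exp_plus, Rplus_opp_l, exp_0; auto).
assert (K : 0 <= (exp (- x) - exp x + 2 * x) * exp x) by (apply Rmult_le_pos; [auto|left; apply exp_pos]).
replace ((exp (- x) - exp x + 2 * x) * exp x) with (exp (- x) * exp x - exp x ^ 2 + 2 * x * exp x) in K by ring.
lra.
Qed.

Lemma cont_vert (phi : C -> R) x y : continuous (T := C_UniformSpace) phi (x, y) ->
  continuous (fun v => phi (x, v)) y.
Proof.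
intros H. apply (continuous_comp (fun s => ((x, s) : C)) phi); [|exact H].
apply ccont_pair; [apply continuous_const|apply continuous_id].
Qed.

Lemma left_halfline_open (x : R) : x < 0 -> locally x (fun v => v < 0).
Proof.
intros H. exists (mkposreal (- x) ltac:(lra)). intros v Hv.
change (Rabs (v - x) < - x) in Hv. apply Rabs_lt_between in Hv. lra.
Qed.

Lemma RInt_vert_ex (F : C -> R) x a b : (forall y, continuous (T := C_UniformSpace) F (x, y)) ->
  ex_RInt (fun y => F (x, y)) a b.
Proof.
intros H. apply (ex_RInt_continuous (V := R_CompleteNormedModule)). intros y _. apply cont_vert, H.
Qed.

Lemma RInt_param_derive (F F1 : C -> R) (a b : R) :
  (forall x y, x < 0 -> continuous (T := C_UniformSpace) F (x, y)) ->
  (forall x y, x < 0 -> continuous (T := C_UniformSpace) F1 (x, y)) ->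
  (forall x y, x < 0 -> is_derive (fun s => F (s, y)) x (F1 (x, y))) ->
  forall x, x < 0 -> is_derive (fun s => RInt (fun y => F (s, y)) a b) x (RInt (fun y => F1 (x, y)) a b).
Proof.
intros HF HF1 HD x Hx.
replace (RInt (fun y => F1 (x, y)) a b) with (RInt (fun y => Derive (fun s => F (s, y)) x) a b).
2: { apply RInt_ext. intros y _. apply is_derive_unique, HD, Hx. }
apply (is_derive_RInt_param (fun s y => F (s, y))).
- generalize (left_halfline_open x Hx). apply filter_imp. intros s Hs y _. eexists; apply HD, Hs.
- intros y _. apply (continuity_2d_pt_ext_loc (fun u v => F1 (u, v))).
  + exists (mkposreal (- x) ltac:(lra)). intros u v Hu _. simpl in Hu.
    apply Rabs_lt_between in Hu. symmetry. apply is_derive_unique, HD. lra.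
  + apply cont_2d, HF1, Hx.
- generalize (left_halfline_open x Hx). apply filter_imp. intros s Hs. apply RInt_vert_ex; auto.
Qed.

Lemma ln_Cmod_derive (f1 f2 : R -> R) t d1 d2 : is_derive f1 t d1 -> is_derive f2 t d2 ->
  ((f1 t, f2 t) : C) <> 0%C ->
  is_derive (fun s => ln (Cmod (f1 s, f2 s))) t ((f1 t * d1 + f2 t * d2) / (f1 t ^ 2 + f2 t ^ 2)).
Proof.
intros H1 H2 H0. apply Cmod_gt_0 in H0. unfold Cmod in H0; simpl fst in H0; simpl snd in H0.
assert (Hp : 0 < f1 t ^ 2 + f2 t ^ 2).
{ apply Rnot_le_lt; intros K. rewrite (sqrt_neg_0 _ K) in H0; lra. }
unfold Cmod; simpl fst; simpl snd.
assert (Sq : sqrt (f1 t ^ 2 + f2 t ^ 2) * sqrt (f1 t ^ 2 + f2 t ^ 2) = f1 t ^ 2 + f2 t ^ 2) by (apply sqrt_sqrt; lra).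
evar_last.
- apply (is_derive_comp ln (fun s => sqrt (f1 s ^ 2 + f2 s ^ 2))).
  + apply is_derive_Reals. apply derivable_pt_lim_ln. exact H0.
  + apply (is_derive_comp sqrt (fun s => f1 s ^ 2 + f2 s ^ 2)).
    * apply is_derive_Reals. apply derivable_pt_lim_sqrt. exact Hp.
    * apply (is_derive_plus (V := R_NormedModule) (fun s => f1 s ^ 2) (fun s => f2 s ^ 2)).
      apply (is_derive_pow f1 2 t d1 H1). apply (is_derive_pow f2 2 t d2 H2).
- unfold plus, scal; simpl; unfold mult; simpl.
  simpl in Sq, H0, Hp. rewrite <- Sq at 3. field; lra.
Qed.

(** * Growth of the integral means of the derivative *)

(** The derivative of [log k(e^w)] with respect to [w], at [z = e^w]. *)
Definition log_slope (k : C -> C) (z : C) : C := (z * C_derive k z / k z)%C.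

Definition nonvanishing (k : C -> C) : Prop := forall z, Cmod z < 1 -> k z <> 0%C.

Lemma holo_log_slope k : holomorphic k -> nonvanishing k -> holomorphic (log_slope k).
Proof.
intros Hk Hn z Hz. destruct (holo_C_derive k Hk z Hz) as [m Hm]. eexists.
apply (cderiv_div (fun z => z * C_derive k z)%C k); [apply Hn, Hz| |apply holo_deriv; auto].
apply (cderiv_mult (fun z => z)); [apply cderiv_id|exact Hm].
Qed.

Definition mod_pow (k : C -> C) (p : R) (w : C) : R := Rpower (Cmod (k (cexp w))) p.

Lemma cexp_disk x y : x < 0 -> Cmod (cexp (x, y)) < 1.
Proof. intros H. unfold cexp; rewrite Cmod_circ. apply exp_lt_1, H. Qed.

Lemma cont_cexp q x y : disk_cont q -> x < 0 ->
  ccontinuous (fun w => q (cexp w)) (x, y).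
Proof.
intros Hq Hx. apply (continuous_comp cexp q); [apply (cderiv_cont _ _ _ (cexp_deriv _))|].
apply Hq, cexp_disk, Hx.
Qed.

Lemma norm_sqr_pos (z : C) : z <> 0%C -> 0 < fst z ^ 2 + snd z ^ 2.
Proof.
intros H. apply Cmod_gt_0 in H. unfold Cmod in H. apply Rnot_le_lt; intros K.
rewrite (sqrt_neg_0 _ K) in H; lra.
Qed.

Lemma ln_mod_dx k x y : holomorphic k -> nonvanishing k -> x < 0 ->
  is_derive (fun s => ln (Cmod (k (cexp (s, y))))) x (fst (log_slope k (cexp (x, y)))) /\
  is_derive (fun s => ln (Cmod (k (cexp (x, s))))) y (- snd (log_slope k (cexp (x, y)))).
Proof.
intros Hk Hn Hx. set (z := cexp (x, y)). assert (Hz : Cmod z < 1) by (apply cexp_disk; auto).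
pose proof (Hn z Hz) as N.
assert (D : cderiv (fun w => k (cexp w)) (x, y) (C_derive k z * z)%C)
  by (apply (cderiv_comp k cexp); [apply holo_deriv; auto|apply cexp_deriv]).
assert (E : (C_derive k z * z)%C = (log_slope k z * k z)%C) by (unfold log_slope; field; auto).
rewrite E in D. pose proof (norm_sqr_pos _ N) as Q.
destruct (cderiv_dx _ _ _ _ D) as [X1 X2]. destruct (cderiv_dy _ _ _ _ D) as [Y1 Y2].
assert (N' : ((fst (k z), snd (k z)) : C) <> 0%C) by (rewrite <- surjective_pairing; auto).
split.
- replace (fst (log_slope k z)) with ((fst (k z) * fst (log_slope k z * k z)%C + snd (k z) * snd (log_slope k z * k z)%C) / (fst (k z) ^ 2 + snd (k z) ^ 2)).
  + apply (ln_Cmod_derive (fun s => fst (k (cexp (s, y)))) (fun s => snd (k (cexp (s, y)))) x _ _ X1 X2 N').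
  + simpl. simpl in Q. field. lra.
- replace (- snd (log_slope k z)) with ((fst (k z) * (- snd (log_slope k z * k z)%C) + snd (k z) * fst (log_slope k z * k z)%C) / (fst (k z) ^ 2 + snd (k z) ^ 2)).
  + apply (ln_Cmod_derive (fun s => fst (k (cexp (x, s)))) (fun s => snd (k (cexp (x, s)))) y _ _ Y1 Y2 N').
  + simpl. simpl in Q. field. lra.
Qed.

Lemma exp_lin_derive (g : R -> R) p t d : is_derive g t d ->
  is_derive (fun s => exp (p * g s)) t (p * exp (p * g t) * d).
Proof.
intros H. evar_last.
- apply (is_derive_comp exp (fun s => p * g s)).
  + apply is_derive_Reals, derivable_pt_lim_exp.
  + apply (is_derive_scal g t p d H).
- unfold scal; simpl; unfold mult; simpl. ring.
Qed.

Lemma mod_pow_dx k p x y : holomorphic k -> nonvanishing k -> x < 0 ->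
  is_derive (fun s => mod_pow k p (s, y)) x (p * mod_pow k p (x, y) * fst (log_slope k (cexp (x, y)))) /\
  is_derive (fun s => mod_pow k p (x, s)) y (- (p * mod_pow k p (x, y) * snd (log_slope k (cexp (x, y))))).
Proof.
intros Hk Hn Hx. destruct (ln_mod_dx k x y Hk Hn Hx) as [D1 D2].
apply (exp_lin_derive _ p) in D1. apply (exp_lin_derive _ p) in D2.
split; [exact D1|]. rewrite Ropp_mult_distr_r. exact D2.
Qed.

Lemma mod_pow_cont k p x y : holomorphic k -> nonvanishing k -> x < 0 ->
  continuous (T := C_UniformSpace) (mod_pow k p) (x, y).
Proof.
intros Hk Hn Hx.
pose proof (ccont_Cmod _ _ (cont_cexp k x y (holo_cont k Hk) Hx)) as H.
unfold mod_pow, Rpower.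
apply (continuous_comp (fun w => p * ln (Cmod (k (cexp w)))) exp); [|apply continuous_exp].
apply (continuous_scal_r (K := R_AbsRing) (V := R_NormedModule) p (fun w => ln (Cmod (k (cexp w))))).
apply (continuous_comp (fun w => Cmod (k (cexp w))) ln); [exact H|].
apply (filterdiff_continuous ln). eexists. apply is_derive_Reals, derivable_pt_lim_ln.
apply Cmod_gt_0, Hn, cexp_disk, Hx.
Qed.

Lemma mod_pow_pos k p w : 0 < mod_pow k p w.
Proof. apply exp_pos. Qed.

Lemma mult_cont (f g : C -> R) w : continuous (T := C_UniformSpace) f w -> continuous (T := C_UniformSpace) g w ->
  continuous (T := C_UniformSpace) (fun w => f w * g w) w.
Proof. apply (continuous_mult (K := R_AbsRing)). Qed.

Lemma plus_cont (f g : C -> R) w : continuous (T := C_UniformSpace) f w -> continuous (T := C_UniformSpace) g w ->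
  continuous (T := C_UniformSpace) (fun w => f w + g w) w.
Proof. apply (continuous_plus (V := R_NormedModule)). Qed.

Definition pow_mean (k : C -> C) (p x : R) : R := RInt (fun y => mod_pow k p (x, y)) 0 (2 * PI).

(** Adding the integral of [u_yy], which vanishes by periodicity, to that of
    [u_xx] gives the integral of the Laplacian [p^2 u |L|^2], in which no second
    derivative of [k] is left. *)
Lemma mean_differential_inequality k p a : holomorphic k -> nonvanishing k ->
  (forall x y, x < 0 -> Cmod (log_slope k (cexp (x, y))) <= a / (- x)) ->
  exists J1 J2 : R -> R, forall x, x < 0 ->
    is_derive (pow_mean k p) x (J1 x) /\ is_derive J1 x (J2 x) /\ J2 x <= (p * a) ^ 2 / x ^ 2 * pow_mean k p x.
Proof.
intros Hk Hn Ha.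
set (u := mod_pow k p).
set (L := fun w => log_slope k (cexp w)).
set (L' := fun w => (C_derive (log_slope k) (cexp w) * cexp w)%C).
pose proof (holo_log_slope k Hk Hn) as Hl.
assert (Cu : forall x y, x < 0 -> continuous (T := C_UniformSpace) u (x, y)) by (intros; apply mod_pow_cont; auto).
assert (CL : forall x y, x < 0 -> ccontinuous L (x, y))
  by (intros; apply (cont_cexp (log_slope k)); [apply holo_cont|]; auto).
assert (CL' : forall x y, x < 0 -> ccontinuous L' (x, y)).
{ intros x y Hx. apply ccont_mult; [|apply (cderiv_cont _ _ _ (cexp_deriv _))].
  apply (cont_cexp (C_derive (log_slope k))); auto. apply holo_cont, holo_C_derive, Hl. }
assert (DL : forall x y, x < 0 -> cderiv L (x, y) (L' (x, y))).
{ intros x y Hx. apply (cderiv_comp (log_slope k) cexp); [|apply cexp_deriv].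
  apply holo_deriv; auto. apply cexp_disk, Hx. }
set (F1 := fun w => p * u w * fst (L w)).
(* [F1 = u_x], [F2 = u_xx], [G1 = u_y], [G2 = u_yy]; by the Cauchy-Riemann
   equations the [L']-terms of [F2] and [G2] cancel *)
set (F2 := fun w => p * (p * u w * fst (L w)) * fst (L w) + p * u w * fst (L' w)).
set (G1 := fun w => - (p * u w * snd (L w))).
set (G2 := fun w => p * (p * u w * snd (L w)) * snd (L w) + - (p * u w * fst (L' w))).
assert (Cc : forall c x y, continuous (T := C_UniformSpace) (U := R_UniformSpace) (fun _ : C => c) ((x, y) : C)) by (intros; apply continuous_const).
assert (Cpu : forall x y, x < 0 -> continuous (T := C_UniformSpace) (fun w => p * u w) (x, y)).
{ intros x y Hx. exact (mult_cont _ _ _ (Cc p x y) (Cu x y Hx)). }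
assert (CL1 : forall x y, x < 0 -> continuous (T := C_UniformSpace) (fun w => fst (L w)) (x, y))
  by (intros x y Hx; apply (ccont_fst L), CL, Hx).
assert (CL2 : forall x y, x < 0 -> continuous (T := C_UniformSpace) (fun w => snd (L w)) (x, y))
  by (intros x y Hx; apply (ccont_snd L), CL, Hx).
assert (CL3 : forall x y, x < 0 -> continuous (T := C_UniformSpace) (fun w => p * u w * fst (L' w)) (x, y)).
{ intros x y Hx. exact (mult_cont _ _ _ (Cpu x y Hx) (ccont_fst L' _ (CL' x y Hx))). }
assert (C1 : forall x y, x < 0 -> continuous (T := C_UniformSpace) F1 (x, y)).
{ intros x y Hx. exact (mult_cont _ _ _ (Cpu x y Hx) (CL1 x y Hx)). }
assert (C2 : forall x y, x < 0 -> continuous (T := C_UniformSpace) F2 (x, y)).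
{ intros x y Hx. exact (plus_cont _ _ _
    (mult_cont _ _ _ (mult_cont _ _ _ (Cc p x y) (C1 x y Hx)) (CL1 x y Hx)) (CL3 x y Hx)). }
assert (C3 : forall x y, x < 0 -> continuous (T := C_UniformSpace) G2 (x, y)).
{ intros x y Hx. exact (plus_cont _ _ _
    (mult_cont _ _ _ (mult_cont _ _ _ (Cc p x y) (mult_cont _ _ _ (Cpu x y Hx) (CL2 x y Hx))) (CL2 x y Hx))
    (continuous_opp (V := R_NormedModule) _ _ (CL3 x y Hx))). }
assert (D1 : forall x y, x < 0 -> is_derive (fun s => u (s, y)) x (F1 (x, y))).
{ intros x y Hx. apply (mod_pow_dx k p x y Hk Hn Hx). }
assert (D2 : forall x y, x < 0 -> is_derive (fun s => F1 (s, y)) x (F2 (x, y))).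
{ intros x y Hx. unfold F1, F2.
  apply (is_derive_mult (K := R_AbsRing) (fun s => p * u (s, y)) (fun s => fst (L (s, y)))).
  - apply (is_derive_scal (fun s => u (s, y))), D1, Hx.
  - apply (cderiv_dx L), DL, Hx.
  - apply Rmult_comm. }
assert (D3 : forall x y, x < 0 -> is_derive (fun s => G1 (x, s)) y (G2 (x, y))).
{ intros x y Hx. unfold G1, G2.
  replace (p * (p * u (x, y) * snd (L (x, y))) * snd (L (x, y)) + - (p * u (x, y) * fst (L' (x, y))))
    with (- (p * (- (p * u (x, y) * snd (L (x, y)))) * snd (L (x, y)) + p * u (x, y) * fst (L' (x, y)))) by ring.
  apply (is_derive_opp (fun s => p * u (x, s) * snd (L (x, s)))).
  apply (is_derive_mult (K := R_AbsRing) (fun s => p * u (x, s)) (fun s => snd (L (x, s)))).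
  - apply (is_derive_scal (fun s => u (x, s))). apply (mod_pow_dx k p x y Hk Hn Hx).
  - apply (cderiv_dy L), DL, Hx.
  - apply Rmult_comm. }
assert (I0 : forall x, x < 0 -> is_RInt (fun y => G2 (x, y)) 0 (2 * PI) 0).
{ intros x Hx.
  assert (E : minus (G1 (x, 2 * PI)) (G1 (x, 0)) = 0).
  { assert (P : cexp (x, 2 * PI) = cexp (x, 0)) by exact (circ_period x).
    unfold G1, u, L, mod_pow. rewrite P. apply Rminus_diag. }
  cut (is_RInt (fun y => G2 (x, y)) 0 (2 * PI) (minus (G1 (x, 2 * PI)) (G1 (x, 0)))); [rewrite E; auto|].
  apply (is_RInt_derive (fun y => G1 (x, y)) (fun y => G2 (x, y))).
  - intros y _. apply D3, Hx.
  - intros y _. apply cont_vert, C3, Hx. }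
exists (fun x => RInt (fun y => F1 (x, y)) 0 (2 * PI)), (fun x => RInt (fun y => F2 (x, y)) 0 (2 * PI)).
intros x Hx. split; [|split].
- apply (RInt_param_derive u F1); auto.
- apply (RInt_param_derive F1 F2); auto.
- assert (E : RInt (fun y => F2 (x, y)) 0 (2 * PI) = RInt (fun y => F2 (x, y) + G2 (x, y)) 0 (2 * PI)).
  { pose proof (is_RInt_unique (V := R_CompleteNormedModule) _ _ _ _ (I0 x Hx)) as E0.
    pose proof (RInt_plus (V := R_CompleteNormedModule) (fun y => F2 (x, y)) (fun y => G2 (x, y)) 0 (2 * PI)
      (RInt_vert_ex F2 x _ _ (fun y => C2 x y Hx)) (RInt_vert_ex G2 x _ _ (fun y => C3 x y Hx))) as E1.
    rewrite E0 in E1. rewrite <- (Rplus_0_r (RInt _ _ _)) at 1. symmetry. exact E1. }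
  rewrite E. unfold pow_mean. fold u.
  assert (Sc : RInt (fun y => (p * a) ^ 2 / x ^ 2 * u (x, y)) 0 (2 * PI) = (p * a) ^ 2 / x ^ 2 * RInt (fun y => u (x, y)) 0 (2 * PI)).
  { apply (RInt_scal (V := R_CompleteNormedModule)). apply RInt_vert_ex. auto. }
  rewrite <- Sc. apply RInt_le; [apply PI2_pos| | |].
  + apply (RInt_vert_ex (fun w => F2 w + G2 w)). intros y. apply plus_cont; auto.
  + apply (ex_RInt_scal (V := R_NormedModule)). apply RInt_vert_ex; auto.
  + intros y _. unfold F2, G2.
    replace (p * (p * u (x, y) * fst (L (x, y))) * fst (L (x, y)) + p * u (x, y) * fst (L' (x, y)) +
      (p * (p * u (x, y) * snd (L (x, y))) * snd (L (x, y)) + - (p * u (x, y) * fst (L' (x, y)))))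
      with (p ^ 2 * Cmod (L (x, y)) ^ 2 * u (x, y)) by (rewrite Cmod2_alt; unfold Re, Im; ring).
    apply Rmult_le_compat_r; [left; apply mod_pow_pos|].
    replace ((p * a) ^ 2 / x ^ 2) with (p ^ 2 * (a / - x) ^ 2) by (field; lra).
    apply Rmult_le_compat_l; [apply pow2_ge_0|].
    apply pow_incr. split; [apply Cmod_ge_0|apply Ha, Hx].
Qed.

(** The function [v = (-x)^(-b)] satisfies [v'' = b (b + 1) v / x^2], so the
    Wronskian [W = J1 v - J v1] is nonincreasing, and [(J / v)' = W / v^2] is
    bounded above on [[-2, 0)]. *)
Lemma ode_comparison (J J1 J2 : R -> R) b : 0 <= b ->
  (forall x, x < 0 -> is_derive J x (J1 x) /\ is_derive J1 x (J2 x) /\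
     J2 x <= b * (b + 1) / x ^ 2 * J x) ->
  exists K, 0 <= K /\ forall x, -2 <= x < 0 -> J x <= K * Rpower (- x) (- b).
Proof.
intros Hb H.
set (v := fun x => Rpower (- x) (- b)).
set (v1 := fun x => b / (- x) * v x).
assert (Dv : forall x, x < 0 -> is_derive v x (v1 x)).
{ intros x Hx. unfold v1, v, Rpower. auto_derive; [lra|]. field. lra. }
assert (Dv1 : forall x, x < 0 -> is_derive v1 x (b * (b + 1) / x ^ 2 * v x)).
{ intros x Hx. unfold v1 at 1. evar_last.
  - apply (is_derive_mult (K := R_AbsRing) (fun x => b / (- x)) v); [|apply Dv, Hx|apply Rmult_comm].
    instantiate (1 := b / x ^ 2). auto_derive; [lra|]. field. lra.
  - unfold plus, mult; simpl. unfold v1. field. lra. }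
assert (Pv : forall x, 0 < v x) by (intros; apply exp_pos).
set (W := fun x => J1 x * v x - J x * v1 x).
assert (DW : forall x, x < 0 -> is_derive W x (J2 x * v x - J x * (b * (b + 1) / x ^ 2 * v x))).
{ intros x Hx. destruct (H x Hx) as (H1 & H2 & _). unfold W. evar_last.
  - apply (is_derive_minus (V := R_NormedModule) (fun x => J1 x * v x) (fun x => J x * v1 x)).
    + apply (is_derive_mult (K := R_AbsRing) J1 v); [exact H2|apply Dv, Hx|apply Rmult_comm].
    + apply (is_derive_mult (K := R_AbsRing) J v1); [exact H1|apply Dv1, Hx|apply Rmult_comm].
  - unfold plus, minus, opp, plus, mult; simpl. ring. }
assert (MW : forall x, -2 <= x < 0 -> W x <= W (-2)).
{ intros x [[H2|H2] Hx]; [|rewrite H2; lra].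
  destruct (MVT_cor2 W (fun x => J2 x * v x - J x * (b * (b + 1) / x ^ 2 * v x)) (-2) x H2) as [c [E Hc]].
  { intros c Hc. apply is_derive_Reals, DW. lra. }
  destruct (H c ltac:(lra)) as (_ & _ & H3). specialize (Pv c).
  assert (J2 c * v c <= b * (b + 1) / c ^ 2 * J c * v c) by (apply Rmult_le_compat_r; lra).
  assert (0 <= (J c * (b * (b + 1) / c ^ 2 * v c) - J2 c * v c) * (x - -2)) by (apply Rmult_le_pos; lra).
  lra. }
assert (Lv : forall x, -2 <= x < 0 -> v (-2) <= v x).
{ intros x Hx. unfold v. rewrite !Rpower_Ropp. apply Rinv_le_contravar; [apply exp_pos|].
  apply Rle_Rpower_l; lra. }
set (Q := fun x => J x / v x).
assert (DQ : forall x, x < 0 -> is_derive Q x (W x / v x ^ 2)).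
{ intros x Hx. destruct (H x Hx) as (H1 & _). unfold Q, W. evar_last.
  - apply (is_derive_div J v); [exact H1|apply Dv, Hx|apply Rgt_not_eq, Pv].
  - simpl. specialize (Pv x). field. lra. }
set (M := Rabs (W (-2)) / v (-2) ^ 2).
assert (HM : 0 <= M) by (apply Rdiv_le_0_compat; [apply Rabs_pos|apply pow_lt, Pv]).
exists (Rabs (Q (-2)) + M * 2). split. { pose proof (Rabs_pos (Q (-2))); lra. }
intros x Hx. change (Rpower (- x) (- b)) with (v x).
assert (B : Q x <= Rabs (Q (-2)) + M * 2).
{ destruct (proj1 Hx) as [H2|H2]; [|rewrite <- H2; pose proof (Rle_abs (Q (-2))); lra].
  destruct (MVT_cor2 Q (fun x => W x / v x ^ 2) (-2) x H2) as [c [E Hc]].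
  { intros c Hc. apply is_derive_Reals, DQ. lra. }
  assert (W c / v c ^ 2 <= M).
  { pose proof (Lv c ltac:(lra)). pose proof (MW c ltac:(lra)). pose proof (Pv (-2)). pose proof (Rle_abs (W (-2))).
    apply Rle_trans with (Rabs (W (-2)) / v c ^ 2).
    - apply Rmult_le_compat_r; [left; apply Rinv_0_lt_compat, pow_lt, Pv|lra].
    - apply Rmult_le_compat_l; [apply Rabs_pos|]. apply Rinv_le_contravar; [apply pow_lt; auto|apply pow_incr; lra]. }
  pose proof (Rle_abs (Q (-2))).
  assert (W c / v c ^ 2 * (x - -2) <= M * 2) by (apply Rle_trans with (M * (x - -2)); [apply Rmult_le_compat_r|apply Rmult_le_compat_l]; lra).
  lra. }
replace (J x) with (Q x * v x) by (unfold Q; field; apply Rgt_not_eq, Pv).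
apply Rmult_le_compat_r; [left; apply Pv|exact B].
Qed.

(** * Summation over dyadic radii *)

Lemma log_slope_bound k a x y : x < 0 ->
  (forall z, Cmod z < 1 -> (1 - Cmod z ^ 2) * Cmod (C_derive k z / k z)%C <= 2 * a) ->
  k (cexp (x, y)) <> 0%C ->
  Cmod (log_slope k (cexp (x, y))) <= a / (- x).
Proof.
intros Hx H N. specialize (H _ (cexp_disk x y Hx)).
set (z := cexp (x, y)) in *. assert (Ez : Cmod z = exp x) by apply Cmod_circ.
unfold log_slope. replace (z * C_derive k z / k z)%C with (z * (C_derive k z / k z))%C by (field; auto).
rewrite Cmod_mult. rewrite Ez in *. pose proof (Cmod_ge_0 (C_derive k z / k z)) as P.
set (m := Cmod (C_derive k z / k z)) in *. pose proof (sinh_bound x ltac:(lra)) as S.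
apply Rmult_le_reg_r with (- x); [lra|].
replace (a / - x * - x) with a by (field; lra).
assert ((- 2 * x * exp x) * m <= (1 - exp x ^ 2) * m) by (apply Rmult_le_compat_r; auto).
lra.
Qed.

(** Between [x1] and [x1 / 2] the logarithm of [|k|] has slope at most
    [a / (- x1 / 2)] over a distance of at most [- x1 / 2]. *)
Lemma modulus_doubling k a x1 x y : holomorphic k -> nonvanishing k -> 0 <= a ->
  (forall x y, x < 0 -> Cmod (log_slope k (cexp (x, y))) <= a / (- x)) ->
  x1 < 0 -> x1 <= x <= x1 / 2 ->
  Cmod (k (cexp (x, y))) <= exp a * Cmod (k (cexp (x1, y))).
Proof.
intros Hk Hn Ha HL H1 [[Hx|Hx] Hx2].
2: { rewrite <- Hx. rewrite <- (Rmult_1_l (Cmod _)) at 1. apply Rmult_le_compat_r; [apply Cmod_ge_0|].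
     destruct Ha as [Ha|Ha]; [left; rewrite <- exp_0; apply exp_increasing; auto|rewrite <- Ha, exp_0; lra]. }
assert (P : forall s, s < 0 -> 0 < Cmod (k (cexp (s, y)))) by (intros s Hs; apply Cmod_gt_0, Hn, cexp_disk, Hs).
destruct (MVT_cor2 (fun s => ln (Cmod (k (cexp (s, y))))) (fun s => fst (log_slope k (cexp (s, y)))) x1 x Hx) as [c [E Hc]].
{ intros c Hc. apply is_derive_Reals. apply ln_mod_dx; auto; lra. }
rewrite <- (exp_ln (Cmod (k (cexp (x, y))))) by (apply P; lra).
rewrite <- (exp_ln (Cmod (k (cexp (x1, y))))) by (apply P; lra).
rewrite <- exp_plus. 
assert (B : fst (log_slope k (cexp (c, y))) * (x - x1) <= a).
{ specialize (HL c y ltac:(lra)). pose proof (Rabs_fst_le_Cmod (log_slope k (cexp (c, y)))) as F.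
  pose proof (Rle_abs (fst (log_slope k (cexp (c, y))))) as G.
  apply Rle_trans with (a / - c * (x - x1)); [apply Rmult_le_compat_r; lra|].
  apply Rle_trans with (a / - c * - c); [|right; field; lra].
  apply Rmult_le_compat_l; [apply Rdiv_le_0_compat; lra|lra]. }
assert (B' : ln (Cmod (k (cexp (x, y)))) <= a + ln (Cmod (k (cexp (x1, y))))) by lra.
destruct B' as [B'|B']; [left; apply exp_increasing, B'|rewrite B'; lra].
Qed.

Lemma radial_increment k q a x1 y : holomorphic k -> nonvanishing k -> 0 <= a ->
  (forall x y, x < 0 -> Cmod (log_slope k (cexp (x, y))) <= a / (- x)) ->
  holomorphic q -> (forall z, Cmod z < 1 -> Cmod (C_derive q z) <= Cmod (k z)) -> x1 < 0 ->
  Cmod (q (cexp ((x1 / 2)%R, y)) - q (cexp (x1, y)))%C <= exp a * (- x1) * Cmod (k (cexp (x1, y))).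
Proof.
intros Hk Hn Ha HL Hq Hqk H1.
set (D := fun x => (C_derive q (cexp (x, y)) * cexp (x, y))%C).
set (M := exp a * Cmod (k (cexp (x1, y)))).
assert (HD : forall x, x < 0 -> cderiv (fun w => q (cexp w)) (x, y) (D x)).
{ intros x Hx. apply (cderiv_comp q cexp); [apply holo_deriv; auto; apply cexp_disk, Hx|apply cexp_deriv]. }
assert (HB : forall x, x1 <= x <= x1 / 2 -> Cmod (D x) <= M).
{ intros x Hx. apply Rle_trans with (Cmod (k (cexp (x, y)))).
  - unfold D. rewrite Cmod_mult. rewrite <- (Rmult_1_r (Cmod (k _))).
    apply Rmult_le_compat; auto using Cmod_ge_0; [apply Hqk|left]; apply cexp_disk; lra.
  - apply modulus_doubling; auto. }
destruct (MVT_cor2 (fun s => fst (q (cexp (s, y)))) (fun s => fst (D s)) x1 (x1 / 2) ltac:(lra)) as [c [E Hc]].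
{ intros c Hc. apply is_derive_Reals. apply (cderiv_dx (fun w => q (cexp w))), HD. lra. }
destruct (MVT_cor2 (fun s => snd (q (cexp (s, y)))) (fun s => snd (D s)) x1 (x1 / 2) ltac:(lra)) as [d [F Hd]].
{ intros d Hd. apply is_derive_Reals. apply (cderiv_dx (fun w => q (cexp w))), HD. lra. }
eapply Rle_trans; [apply Cmod_le_sum|].
set (A := q (cexp (x1 / 2, y))) in *. set (A' := q (cexp (x1, y))) in *.
change (fst (A - A')%C) with (fst A - fst A'). change (snd (A - A')%C) with (snd A - snd A').
rewrite E, F, !Rabs_mult, (Rabs_right (x1 / 2 - x1)) by lra.
pose proof (HB c ltac:(lra)). pose proof (HB d ltac:(lra)).
pose proof (Rabs_fst_le_Cmod (D c)). pose proof (Rabs_snd_le_Cmod (D d)).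
assert (Rabs (fst (D c)) * (x1 / 2 - x1) <= M * (x1 / 2 - x1)) by (apply Rmult_le_compat_r; lra).
assert (Rabs (snd (D d)) * (x1 / 2 - x1) <= M * (x1 / 2 - x1)) by (apply Rmult_le_compat_r; lra).
replace (exp a * - x1 * Cmod (k (cexp (x1, y)))) with (M * - x1) by (unfold M; ring). lra.
Qed.

Lemma dyadic_scale t : 0 < t < 2 -> exists N, 1 <= 2 ^ N * t < 2.
Proof.
intros [H0 H2].
destruct (Pow_x_infinity 2 ltac:(rewrite Rabs_right; lra) (/ t)) as [n Hn].
specialize (Hn n (le_n _)). rewrite Rabs_right in Hn by (apply Rle_ge, pow_le; lra).
assert (H1 : 1 <= 2 ^ n * t).
{ replace 1 with (/ t * t) by (field; lra). apply Rmult_le_compat_r; lra. }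
clear Hn. revert t H0 H2 H1. induction n as [|n IH]; intros t H0 H2 H1.
- exists 0%nat. simpl in *; lra.
- destruct (Rle_lt_dec 1 t) as [Ht|Ht].
  + exists 0%nat; simpl; lra.
  + destruct (IH (2 * t)) as [N HN]; try lra.
    * replace (2 ^ n * (2 * t)) with (2 ^ S n * t) by (simpl; ring). auto.
    * exists (S N). replace (2 ^ S N * t) with (2 ^ N * (2 * t)) by (simpl; ring). auto.
Qed.

Lemma dyadic_lt N t : 0 < t -> 2 ^ N * t < 2 -> t < 2.
Proof.
intros Ht H. apply Rle_lt_trans with (2 := H). rewrite <- (Rmult_1_l t) at 1.
apply Rmult_le_compat_r; [lra|]. apply pow_R1_Rle; lra.
Qed.

(** The sum of [s^(c p) |k(e^(- s + i y))|^p] over [s = 2 t, 4 t, ..., 2^N t].  Peeling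
    off the term [s = 2 t] matches the inductions, which pass from [2 t] to [t]. *)
Fixpoint dyadic_sum (k : C -> C) (p c : R) (N : nat) (t y : R) : R :=
  match N with
  | O => 0
  | S N => Rpower (2 * t) (c * p) * mod_pow k p (- (2 * t), y) + dyadic_sum k p c N (2 * t) y
  end.

Lemma dyadic_sum_nonneg k p c N : forall t y, 0 <= dyadic_sum k p c N t y.
Proof.
induction N as [|N IH]; intros t y; simpl; [lra|].
apply Rplus_le_le_0_compat; auto. left; apply Rmult_lt_0_compat; apply exp_pos.
Qed.

Lemma dyadic_sum_cont k p c N : holomorphic k -> nonvanishing k -> forall t y, 0 < t ->
  continuous (dyadic_sum k p c N t) y.
Proof.
intros Hk Hn; induction N as [|N IH]; intros t y Ht; simpl; [apply continuous_const|].
apply (continuous_plus (V := R_NormedModule) (fun y => Rpower (2 * t) (c * p) * mod_pow k p (- (2 * t), y))); [|apply IH; lra].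
apply (continuous_scal_r (K := R_AbsRing) (V := R_NormedModule) (Rpower (2 * t) (c * p)) (fun y => mod_pow k p (- (2 * t), y))).
apply cont_vert, mod_pow_cont; auto; lra.
Qed.

Lemma continuous_ex_RInt (f : R -> R) a b : (forall y, continuous f y) -> ex_RInt f a b.
Proof. intros H; apply (ex_RInt_continuous (V := R_CompleteNormedModule)); auto. Qed.

Lemma Rpower_gt_1 x y : 1 < x -> 0 < y -> 1 < Rpower x y.
Proof. intros Hx Hy. rewrite <- (Rpower_O x) by lra. apply Rpower_lt; auto. Qed.

Lemma Rpower_pos x y : 0 < Rpower x y.
Proof. apply exp_pos. Qed.

(** Sums of [s^e] over [s = 2 t, 4 t, ...] are replaced by the telescoping closed
    form on the right, which is stable under adding the term [s = 2 t]. *)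
Lemma geometric_step e K t : 0 < e -> 0 < t ->
  K * Rpower (2 * t) e + K / (Rpower 2 e - 1) * (Rpower 4 e - Rpower (2 * (2 * t)) e)
  = K / (Rpower 2 e - 1) * (Rpower 4 e - Rpower (2 * t) e).
Proof.
intros He Ht. pose proof (Rpower_gt_1 2 e ltac:(lra) He).
rewrite <- (Rpower_mult_distr 2 (2 * t)) by lra. field. lra.
Qed.

Lemma geometric_nonneg e K t : 0 < e -> 0 <= K -> 0 < t < 2 ->
  0 <= K / (Rpower 2 e - 1) * (Rpower 4 e - Rpower (2 * t) e) <= K / (Rpower 2 e - 1) * Rpower 4 e.
Proof.
intros He HK Ht. pose proof (Rpower_gt_1 2 e ltac:(lra) He).
assert (0 <= K / (Rpower 2 e - 1)) by (apply Rdiv_le_0_compat; lra).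
assert (Rpower (2 * t) e <= Rpower 4 e) by (apply Rle_Rpower_l; lra).
pose proof (Rpower_pos (2 * t) e).
split; [apply Rmult_le_pos; lra|apply Rmult_le_compat_l; lra].
Qed.

Lemma dyadic_sum_integral k p c b K N : holomorphic k -> nonvanishing k -> 0 <= K -> b < c * p ->
  (forall x, -2 <= x < 0 -> pow_mean k p x <= K * Rpower (- x) (- b)) ->
  forall t, 0 < t -> 2 ^ N * t < 2 ->
  RInt (dyadic_sum k p c N t) 0 (2 * PI) <= K / (Rpower 2 (c * p - b) - 1) * (Rpower 4 (c * p - b) - Rpower (2 * t) (c * p - b)).
Proof.
intros Hk Hn HK Hb HJ. induction N as [|N IH]; intros t Ht H2.
- simpl. rewrite RInt_const. unfold scal; simpl; unfold mult; simpl. rewrite Rmult_0_r.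
  simpl in H2. apply geometric_nonneg; lra.
- assert (H2' : 2 ^ N * (2 * t) < 2) by (replace (2 ^ N * (2 * t)) with (2 ^ S N * t) by (simpl; ring); auto).
  pose proof (dyadic_lt N (2 * t) ltac:(lra) H2') as H4.
  pose proof (IH (2 * t) ltac:(lra) H2') as I.
  specialize (HJ (- (2 * t)) ltac:(lra)). rewrite Ropp_involutive in HJ.
  set (F := fun y => mod_pow k p (- (2 * t), y)).
  assert (EF : ex_RInt F 0 (2 * PI)) by (apply RInt_vert_ex; intros; apply mod_pow_cont; auto; lra).
  assert (E : RInt (dyadic_sum k p c (S N) t) 0 (2 * PI)
    = Rpower (2 * t) (c * p) * pow_mean k p (- (2 * t)) + RInt (dyadic_sum k p c N (2 * t)) 0 (2 * PI)).
  { unfold pow_mean. fold F.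
    transitivity (plus (RInt (fun y => scal (Rpower (2 * t) (c * p)) (F y)) 0 (2 * PI)) (RInt (dyadic_sum k p c N (2 * t)) 0 (2 * PI))).
    - apply (RInt_plus (V := R_CompleteNormedModule) (fun y => scal (Rpower (2 * t) (c * p)) (F y)) (dyadic_sum k p c N (2 * t))).
      + apply (ex_RInt_scal (V := R_NormedModule)), EF.
      + apply continuous_ex_RInt. intros y. apply dyadic_sum_cont; auto; lra.
    - rewrite (RInt_scal (V := R_CompleteNormedModule)) by exact EF. reflexivity. }
  rewrite E, <- geometric_step by lra. apply Rplus_le_compat; [|exact I].
  apply Rle_trans with (Rpower (2 * t) (c * p) * (K * Rpower (2 * t) (- b))).
  + apply Rmult_le_compat_l; [left; apply Rpower_pos|exact HJ].
  + right. unfold Rminus. rewrite Rpower_plus. ring.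
Qed.

Lemma Rpower_le_inv x y p : 0 < x -> 0 < y -> 0 < p -> Rpower x p <= Rpower y p -> x <= y.
Proof.
intros Hx Hy Hp H. apply Rnot_lt_le; intros K.
pose proof (Rlt_Rpower_l y x p Hp (conj Hy K)). lra.
Qed.

(** If the dyadic sum is at most [M^p], each of its terms gives [s^c |k| <= M], so
    the increment at scale [s] is at most [A M s^(1 - c)], a geometric sequence. *)
Lemma dyadic_sum_controls (f k : C -> C) p c A B N : nonvanishing k -> 0 < p -> c < 1 -> 0 <= A ->
  (forall x y, x <= -1 -> Cmod (f (cexp (x, y))) <= B) ->
  (forall t y, 0 < t -> Cmod (f (cexp (- t, y))) <= Cmod (f (cexp (- (2 * t), y))) + A * (2 * t) * Cmod (k (cexp (- (2 * t), y)))) ->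
  forall t y M, 0 < t -> 1 <= 2 ^ N * t < 2 -> 0 < M -> dyadic_sum k p c N t y <= Rpower M p ->
  Cmod (f (cexp (- t, y))) <= B + A * M / (Rpower 2 (1 - c) - 1) * (Rpower 4 (1 - c) - Rpower (2 * t) (1 - c)).
Proof.
intros Hn Hp Hc HA HB Hf. induction N as [|N IH]; intros t y M Ht H2 HM HS.
- simpl in H2.
  pose proof (HB (- t) y ltac:(lra)).
  pose proof (geometric_nonneg (1 - c) (A * M) t ltac:(lra) ltac:(apply Rmult_le_pos; lra) ltac:(lra)). lra.
- assert (H2' : 1 <= 2 ^ N * (2 * t) < 2) by (replace (2 ^ N * (2 * t)) with (2 ^ S N * t) by (simpl; ring); auto).
  pose proof (dyadic_lt N (2 * t) ltac:(lra) (proj2 H2')) as H4.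
  simpl in HS. pose proof (dyadic_sum_nonneg k p c N (2 * t) y) as P1.
  set (m := Cmod (k (cexp (- (2 * t), y)))).
  assert (Pm : 0 < m) by (apply Cmod_gt_0, Hn, cexp_disk; lra).
  assert (P2 : 0 < Rpower (2 * t) (c * p) * mod_pow k p (- (2 * t), y)) by (apply Rmult_lt_0_compat; apply exp_pos).
  assert (Hm : Rpower (2 * t) c * m <= M).
  { apply (Rpower_le_inv _ _ p); auto.
    - apply Rmult_lt_0_compat; [apply Rpower_pos|auto].
    - rewrite <- Rpower_mult_distr by (auto using Rpower_pos). rewrite Rpower_mult.
      change (Rpower m p) with (mod_pow k p (- (2 * t), y)). lra. }
  pose proof (IH (2 * t) y M ltac:(lra) H2' HM ltac:(lra)) as I.
  specialize (Hf t y Ht). fold m in Hf.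
  rewrite <- geometric_step by lra.
  assert (A * (2 * t) * m <= A * M * Rpower (2 * t) (1 - c)).
  { assert (E : 2 * t = Rpower (2 * t) c * Rpower (2 * t) (1 - c)).
    { rewrite <- Rpower_plus. replace (c + (1 - c)) with 1 by ring. rewrite Rpower_1; lra. }
    rewrite E at 1.
    replace (A * (Rpower (2 * t) c * Rpower (2 * t) (1 - c)) * m) with (A * Rpower (2 * t) (1 - c) * (Rpower (2 * t) c * m)) by ring.
    replace (A * M * Rpower (2 * t) (1 - c)) with (A * Rpower (2 * t) (1 - c) * M) by ring.
    apply Rmult_le_compat_l; [|exact Hm]. apply Rmult_le_pos; [auto|left; apply Rpower_pos]. }
  lra.
Qed.

Lemma rpow_le x y q : 0 <= x <= y -> 0 < y -> 0 < q -> rpow x q <= Rpower y q.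
Proof.
intros Hx Hy Hq. unfold rpow. destruct (Req_EM_T x 0); [left; apply Rpower_pos|].
apply Rle_Rpower_l; lra.
Qed.

Lemma rpow_nonneg x q : 0 <= rpow x q.
Proof. unfold rpow. destruct (Req_EM_T x 0); [lra|left; apply Rpower_pos]. Qed.

Lemma rpow_cont (g : R -> R) p y : 0 < p -> (forall t, 0 <= g t) -> continuous g y ->
  continuous (fun t => rpow (g t) p) y.
Proof.
intros Hp Hg Hc. destruct (Rle_lt_or_eq_dec _ _ (Hg y)) as [H|H].
- assert (L : locally y (fun t => 0 < g t)) by exact (Hc _ (open_gt 0 (g y) H)).
  apply (continuous_ext_loc _ (fun t => Rpower (g t) p)).
  + generalize L; apply filter_imp. intros t Ht. unfold rpow. destruct (Req_EM_T (g t) 0); [lra|reflexivity].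
  + unfold Rpower. apply (continuous_comp (fun t => p * ln (g t)) exp); [|apply continuous_exp].
    apply (continuous_scal_r (K := R_AbsRing) (V := R_NormedModule) p (fun t => ln (g t))).
    apply (continuous_comp g ln); [exact Hc|].
    apply (filterdiff_continuous ln). eexists. apply is_derive_Reals, derivable_pt_lim_ln, H.
- apply filterlim_locally. intros eps.
  assert (L : locally y (fun t => g t < Rpower eps (/ p))).
  { refine (Hc _ (open_lt _ (g y) _)). rewrite <- H. apply Rpower_pos. }
  generalize L; apply filter_imp. intros t Ht.
  change (Rabs (rpow (g t) p - rpow (g y) p) < eps).
  unfold rpow at 2. destruct (Req_EM_T (g y) 0); [|lra].
  rewrite Rminus_0_r, Rabs_right by (apply Rle_ge, rpow_nonneg).
  unfold rpow. destruct (Req_EM_T (g t) 0); [apply cond_pos|].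
  apply Rlt_le_trans with (Rpower (Rpower eps (/ p)) p).
  + apply Rlt_Rpower_l; auto. specialize (Hg t). lra.
  + rewrite Rpower_mult, Rinv_l, Rpower_1 by (try lra; apply cond_pos). lra.
Qed.

Lemma bounded_integrals_hardy p f Q : 0 < p -> harmonic_mapping f -> 0 < Q ->
  (forall x, x < 0 -> RInt (fun y => rpow (Cmod (f (circ x y))) p) 0 (2 * PI) <= Q) ->
  (forall x, x < 0 -> 0 <= RInt (fun y => rpow (Cmod (f (circ x y))) p) 0 (2 * PI)) ->
  hardy_harmonic p f.
Proof.
intros Hp Hf HQ HB H0. split; [exact Hf|]. pose proof PI_RGT_0 as Hpi.
apply Rbar_le_lt_trans with (Finite (Rpower (/ (2 * PI) * Q) (/ p))); [|exact I].
apply Lub_Rbar_correct. intros m [r [Hr ->]].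
assert (Hx : ln r < 0) by (rewrite <- ln_1; apply ln_increasing; lra).
specialize (HB (ln r) Hx). specialize (H0 (ln r) Hx). unfold circ in HB, H0. rewrite exp_ln in HB, H0 by lra.
assert (Hi : 0 < / (2 * PI)) by (apply Rinv_0_lt_compat; lra).
unfold integral_mean. apply rpow_le.
- split; [apply Rmult_le_pos; lra|apply Rmult_le_compat_l; lra].
- apply Rmult_lt_0_compat; lra.
- apply Rinv_0_lt_compat, Hp.
Qed.

(** The positive root [b] of [b (b + 1) = (p a)^2] lies below [p] because
    [(p a)^2 < p (p + 1)]. *)
Lemma critical_exponent p a : 0 < p -> 1 <= a -> p * (a ^ 2 - 1) < 1 ->
  exists b, 0 <= b < p /\ b * (b + 1) = (p * a) ^ 2.
Proof.
intros Hp Ha H. set (D := 1 + 4 * (p * a) ^ 2).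
assert (HD : 1 <= D) by (unfold D; pose proof (pow2_ge_0 (p * a)); lra).
pose proof (sqrt_sqrt D ltac:(lra)) as S. pose proof (sqrt_pos D) as P.
exists ((sqrt D - 1) / 2). split; [split|].
- assert (1 <= sqrt D) by (rewrite <- sqrt_1; apply sqrt_le_1; lra). lra.
- assert (sqrt D < 2 * p + 1); [|lra].
  rewrite <- (sqrt_square (2 * p + 1)) by lra. apply sqrt_lt_1; try lra; [nra|]. unfold D.
  assert (p * (p * (a ^ 2 - 1)) < p * 1) by (apply Rmult_lt_compat_l; lra).
  replace ((p * a) ^ 2) with (p * (p * (a ^ 2 - 1)) + p * p) by ring. lra.
- replace ((sqrt D - 1) / 2 * ((sqrt D - 1) / 2 + 1)) with ((sqrt D * sqrt D - 1) / 4) by field.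
  rewrite S. unfold D. field.
Qed.

(** * Membership in the Hardy space *)

(** With [c] halfway between [b / p] and [1], the dyadic sum [S] satisfies
    [|f|^p <= G^p (S + 1)] on each circle near the boundary, and its integrals are
    bounded independently of the radius.  Inside the circle of radius [e^(-1)],
    where [f] is bounded, [S = 0] serves. *)
Lemma hardy_of_log_derivative_bound (a p : R) (f h g : C -> C) : 1 <= a -> 0 < p -> p * (a ^ 2 - 1) < 1 ->
  harmonic_decomposition f h g -> sense_preserving h g ->
  (forall z, Cmod z < 1 -> (1 - Cmod z ^ 2) * Cmod (C_derive (C_derive h) z / C_derive h z)%C <= 2 * a) ->
  hardy_harmonic p f.
Proof.
intros Ha Hp Hpa Hd Hsp HT. pose proof PI_RGT_0 as Hpi.
assert (Hf : harmonic_mapping f) by (exists h, g; exact Hd).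
destruct Hd as (Hh & Hg & _ & Ef). apply analytic_holo in Hh, Hg.
set (k := C_derive h).
assert (Hk : holomorphic k) by (apply holo_C_derive, Hh).
assert (Hn : nonvanishing k) by (intros z Hz; apply (sense_preserving_neq0 h g); auto).
assert (HL : forall x y, x < 0 -> Cmod (log_slope k (cexp (x, y))) <= a / - x).
{ intros x y Hx. apply log_slope_bound; auto. apply Hn, cexp_disk, Hx. }
destruct (critical_exponent p a Hp Ha Hpa) as [b [[Hb0 Hbp] Hb]].
destruct (mean_differential_inequality k p a Hk Hn HL) as [J1 [J2 HJ]].
rewrite <- Hb in HJ.
destruct (ode_comparison _ J1 J2 b Hb0 HJ) as [K [HK0 HK]].
set (c := (b / p + 1) / 2).
assert (Hbp1 : b / p < 1).
{ apply Rmult_lt_reg_r with (1 := Hp). unfold Rdiv. rewrite Rmult_assoc, Rinv_l; lra. }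
assert (Hc1 : c < 1) by (unfold c; lra).
assert (Hcb : b < c * p) by (replace (c * p) with ((b + p) / 2) by (unfold c; field; lra); lra).
destruct (holo_bounded h (exp (-1)) Hh (exp_lt_1 (-1) ltac:(lra))) as [Bh [HBh0 HBh]].
destruct (holo_bounded g (exp (-1)) Hg (exp_lt_1 (-1) ltac:(lra))) as [Bg [HBg0 HBg]].
set (B := Bh + Bg). set (A := 2 * exp a).
assert (HA : 0 <= A) by (unfold A; pose proof (exp_pos a); lra).
assert (HB : forall x y, x <= -1 -> Cmod (f (cexp (x, y))) <= B).
{ intros x y Hx. rewrite Ef by (apply cexp_disk; lra).
  eapply Rle_trans; [apply Cmod_triangle|]. rewrite Cmod_conj.
  assert (Cmod (cexp (x, y)) <= exp (-1)).
  { unfold cexp; rewrite Cmod_circ. destruct Hx as [Hx| ->]; [left; apply exp_increasing, Hx|apply Rle_refl]. }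
  apply Rplus_le_compat; auto. }
assert (Hfd : forall t y, 0 < t -> Cmod (f (cexp (- t, y)))
   <= Cmod (f (cexp (- (2 * t), y))) + A * (2 * t) * Cmod (k (cexp (- (2 * t), y)))).
{ intros t y Ht. rewrite !Ef by (apply cexp_disk; lra).
  pose proof (radial_increment k h a (- (2 * t)) y Hk Hn ltac:(lra) HL Hh ltac:(intros; apply Rle_refl) ltac:(lra)) as Ih.
  pose proof (radial_increment k g a (- (2 * t)) y Hk Hn ltac:(lra) HL Hg
    (fun z Hz => Rlt_le _ _ (sense_preserving_lt h g z Hsp Hz)) ltac:(lra)) as Ig.
  replace (- (2 * t) / 2) with (- t) in Ih, Ig by field. rewrite Ropp_involutive in Ih, Ig.
  set (z1 := cexp (- t, y)) in *. set (z2 := cexp (- (2 * t), y)) in *.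
  replace (h z1 + Cconj (g z1))%C with ((h z2 + Cconj (g z2)) + ((h z1 - h z2) + Cconj (g z1 - g z2)))%C
    by (rewrite Cminus_conj; ring).
  eapply Rle_trans; [apply Cmod_triangle|]. apply Rplus_le_compat_l.
  eapply Rle_trans; [apply Cmod_triangle|]. rewrite Cmod_conj. unfold A. lra. }
set (C' := A * 1 / (Rpower 2 (1 - c) - 1) * Rpower 4 (1 - c)).
set (D' := K / (Rpower 2 (c * p - b) - 1) * Rpower 4 (c * p - b)).
assert (HC' : 0 <= C') by (pose proof (geometric_nonneg (1 - c) (A * 1) 1 ltac:(lra) ltac:(lra) ltac:(lra)); unfold C'; lra).
assert (HD' : 0 <= D') by (pose proof (geometric_nonneg (c * p - b) K 1 ltac:(lra) ltac:(lra) ltac:(lra)); unfold D'; lra).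
set (G := B + C' + 1).
assert (HB0 : 0 <= B) by (unfold B; lra).
assert (HG : 1 <= G) by (unfold G; lra).
assert (Cont : forall x y, x < 0 -> continuous (fun y => rpow (Cmod (f (circ x y))) p) y).
{ intros x y Hx. apply (rpow_cont (fun y => Cmod (f (circ x y)))); auto; [intros; apply Cmod_ge_0|].
  assert (Dz : forall t, Cmod (circ x t) < 1) by (intros t; rewrite Cmod_circ; apply exp_lt_1, Hx).
  apply (continuous_ext (fun y => Cmod (h (circ x y) + Cconj (g (circ x y)))%C)).
  - intros t. rewrite Ef; auto. apply Dz.
  - apply ccont_Cmod, ccont_plus; [|apply ccont_conj]; apply ccont_circ_y, holo_cont; auto. }
assert (Pt : forall x, x < 0 -> exists S : R -> R, (forall y, 0 <= S y) /\ (forall y, continuous S y) /\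
   RInt S 0 (2 * PI) <= D' /\ forall y, rpow (Cmod (f (circ x y))) p <= Rpower G p * (S y + 1)).
{ intros x Hx. destruct (Rle_lt_dec x (-1)) as [Hx1|Hx1].
  - exists (fun _ => 0). split; [intros; lra|split; [intros; apply continuous_const|split]].
    + rewrite RInt_const. unfold scal; simpl; unfold mult; simpl. lra.
    + intros y. rewrite Rplus_0_l, Rmult_1_r. apply rpow_le; auto; [|lra].
      split; [apply Cmod_ge_0|]. pose proof (HB x y Hx1) as K1. unfold cexp in K1; simpl in K1. unfold G; lra.
  - destruct (dyadic_scale (- x)) as [N HN]; [lra|].
    exists (dyadic_sum k p c N (- x)).
    split; [apply dyadic_sum_nonneg|split; [intros; apply dyadic_sum_cont; auto; lra|split]].
    + eapply Rle_trans; [apply (dyadic_sum_integral k p c b K N); auto; lra|].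
      apply geometric_nonneg; lra.
    + intros y. set (S := dyadic_sum k p c N (- x) y).
      assert (HS : 0 <= S) by apply dyadic_sum_nonneg.
      (* [S + 1] rather than [S], so that [M >= 1] absorbs the constants *)
      set (M := Rpower (S + 1) (/ p)).
      assert (EM : Rpower M p = S + 1) by (unfold M; rewrite Rpower_mult, Rinv_l, Rpower_1; lra).
      assert (HM : 1 <= M).
      { apply (Rpower_le_inv 1 M p); [lra|apply Rpower_pos|auto|]. rewrite EM. unfold Rpower. rewrite ln_1, Rmult_0_r, exp_0. lra. }
      pose proof (dyadic_sum_controls f k p c A B N Hn Hp Hc1 HA HB Hfd (- x) y M ltac:(lra) HN ltac:(lra)) as I.
      rewrite EM in I. specialize (I ltac:(fold S; lra)). rewrite Ropp_involutive in I.
      pose proof (geometric_nonneg (1 - c) (A * M) (- x) ltac:(lra) ltac:(apply Rmult_le_pos; lra) ltac:(lra)) as [_ I2].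
      replace (A * M / (Rpower 2 (1 - c) - 1) * Rpower 4 (1 - c)) with (C' * M) in I2 by (unfold C', Rdiv; ring).
      change (cexp (x, y)) with (circ x y) in I.
      rewrite <- EM, Rpower_mult_distr by lra.
      apply rpow_le; auto; [|apply Rmult_lt_0_compat; lra]. split; [apply Cmod_ge_0|].
      apply Rle_trans with (B + C' * M); [lra|].
      assert (B * 1 <= B * M) by (apply Rmult_le_compat_l; lra).
      unfold G. replace ((B + C' + 1) * M) with (B * M + C' * M + M) by ring. lra. }
pose proof (Rpower_pos G p) as PG.
apply (bounded_integrals_hardy p f (Rpower G p * (D' + 2 * PI))); auto.
- apply Rmult_lt_0_compat; lra.
- intros x Hx. destruct (Pt x Hx) as (S & _ & CS & IS & BS).
  assert (ES : ex_RInt S 0 (2 * PI)) by (apply continuous_ex_RInt; auto).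
  assert (E1 : ex_RInt (fun y => plus (S y) 1) 0 (2 * PI)) by (apply (ex_RInt_plus (V := R_NormedModule)); [exact ES|apply ex_RInt_const]).
  apply Rle_trans with (RInt (fun y => scal (Rpower G p) (plus (S y) 1)) 0 (2 * PI)).
  + apply RInt_le; [apply PI2_pos|apply continuous_ex_RInt; auto|apply (ex_RInt_scal (V := R_NormedModule)), E1|].
    intros y _. apply BS.
  + rewrite (RInt_scal (V := R_CompleteNormedModule)) by exact E1.
    rewrite (RInt_plus (V := R_CompleteNormedModule) S (fun _ => 1)); [|exact ES|apply ex_RInt_const].
    rewrite RInt_const. unfold scal, plus; simpl; unfold mult; simpl.
    apply Rmult_le_compat_l; lra.
- intros x Hx. apply RInt_ge_0; [apply PI2_pos|apply continuous_ex_RInt; auto|].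
  intros y _. apply rpow_nonneg.
Qed.

Theorem theorem8p2 (lambda : R) (hlambda : 1 <= lambda) (p : R) (hp : 0 < p)
    (hp0 : Rbar_lt (Finite p) (p0 lambda)) (f : C -> C)
    (hf : class_BH lambda f) :
  hardy_harmonic p f.
Proof.
destruct hf as (h & g & HH & Hnorm).
apply (hardy_of_log_derivative_bound ((lambda + 1) / 2) p f h g); auto; try apply HH; [lra| |].
- replace (((lambda + 1) / 2) ^ 2 - 1) with ((lambda + 3) * (lambda - 1) / 4) by field.
  unfold p0 in hp0. destruct (Req_EM_T lambda 1) as [->|H1].
  + replace ((1 + 3) * (1 - 1) / 4) with 0 by field. lra.
  + simpl in hp0. assert (Hm : 0 < (lambda + 3) * (lambda - 1)) by (apply Rmult_lt_0_compat; lra).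
    replace 1 with (4 / ((lambda + 3) * (lambda - 1)) * ((lambda + 3) * (lambda - 1) / 4)) at 2 by (field; lra).
    apply Rmult_lt_compat_r; lra.
- intros z Hz. replace (2 * ((lambda + 1) / 2)) with (lambda + 1) by field.
  apply (analytic_pre_schwarzian_bound lambda f h g z HH Hnorm Hz).
Qed.
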